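(* Let $k\geq 2$ and consider a Riemannian product $M^n\times\mathbb{R}^k$ with weight $e^\psi$. Suppose that there exist $\lambda\geq 0$ and $r_0>0$ such that $H_{\psi,r}\geq\lambda$ for any $r\in(0,r_0]$. Let $\Sigma$ be a two-sided, connected and $\psi$-parabolic hypersurface with $\partial\Sigma\neq\emptyset$ contained in $M\times B^k(r_0)$. If the $\psi$-mean curvature of $\Sigma$ satisfies $|H_\psi|\leq\lambda$ and $\Sigma$ is tangent to $M\times\mathbb{S}^{k-1}(r_0)$ along $\partial\Sigma$, then $\Sigma\subseteq M\times\mathbb{S}^{k-1}(r_0)$ and $H_{\psi,r_0}=\lambda$.
   Context: $M^n$ is a connected oriented $n$-dimensional Riemannian manifold, possibly with smooth boundary; $M\times\mathbb{R}^k$ is the Riemannian product with Euclidean space. $B^k(r)$ and $\mathbb{S}^{k-1}(r)$ denote the closed round ball and the round sphere of radius $r>0$ centered at the origin of $\mathbb{R}^k$. A weight $e^\psi$ is a positive $C^1$ function. For a two-sided smooth hypersurface $\Sigma$ (possibly with smooth boundary $\partial\Sigma$) with unit normal $N$, the $\psi$-mean curvature is $H_\psi:=-\operatorname{div}_\Sigma N-\langle\nabla\psi,N\rangle$. For $r>0$, $H_{\psi,r}$ denotes the $\psi$-mean curvature function of $M\times\mathbb{S}^{k-1}(r)$ with respect to the unit normal $(0,-t/r)$ at $(p,t)$; explicitly $H_{\psi,r}=\frac{1}{r}\big(k-1+\langle\nabla\psi,V\rangle\big)$, where $V(p,t):=(0,t)$. On $\Sigma$ with the induced metric, $\Delta_{\Sigma,\psi}u:=\Delta_\Sigma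 u+\langle\nabla_\Sigma\psi,\nabla_\Sigma u\rangle$. $\Sigma$ is $\psi$-parabolic if every $u\in C^2(\Sigma)$ that is bounded from above, satisfies $\Delta_{\Sigma,\psi}u\geq 0$ on $\Sigma\setminus\partial\Sigma$ and $\partial u/\partial\nu\geq 0$ along $\partial\Sigma$ ($\nu$ the inner unit conormal) is constant. $\Sigma$ is tangent to $M\times\mathbb{S}^{k-1}(r_0)$ along $\partial\Sigma$ if $\partial\Sigma\subset M\times\mathbb{S}^{k-1}(r_0)$ and the tangent hyperplanes of both hypersurfaces coincide at every point of $\partial\Sigma$.
   Formalization: The equality H_{ψ,r0} = λ is proved at the points of Σ only, not on all of M×S^{k-1}(r0), where it can fail (e.g. Σ = [-1,1]×S¹ in ℝ×ℝ² with ψ = η(p)|t|²/2, η = 0 on [-1,1] and η > 0 outside). *)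

(* Defs.v *)
From HB Require Import structures.
From mathcomp Require Import all_boot all_order all_algebra.
From mathcomp Require Import all_classical all_reals all_analysis.
Set Implicit Arguments.
Unset Strict Implicit.
Unset Printing Implicit Defensive.
Import Order.TTheory GRing.Theory Num.Theory numFieldNormedType.Exports.
Local Open Scope classical_set_scope.
Local Open Scope ring_scope.

(** Tangent vectors are row vectors, and the Jacobian of f has the a-th partial
    derivative of f as its a-th row. *)

Section Calculus.
Variable R : realType.

(** The model of a manifold with boundary is { x | 0 <= x_0 }; it is all of R^0
    when d = 0. *)
Definition halfspace (d : nat) : set 'rV[R]_d :=
  [set x | forall a : 'I_d, val a = 0%N -> 0 <= x ord0 a].

Definition halfspace_boundary (d : nat) : set 'rV[R]_d :=
  [set x | exists2 a : 'I_d, val a = 0%N & x ord0 a = 0].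

(** Partial derivatives are taken inside the domain U, a relatively open subset
    of a half-space: two-sided at interior points, one-sided in the transverse
    direction at boundary points. *)
Definition pd_quot d (U : set 'rV[R]_d) (a : 'I_d) (f : 'rV[R]_d -> R)
    (x : 'rV[R]_d) : set_system R :=
  (fun h : R => h^-1 * (f (x + h *: delta_mx ord0 a) - f x))
    @ within [set h : R | U (x + h *: delta_mx ord0 a)] (dnbhs (0 : R)).

Definition pd d (U : set 'rV[R]_d) (a : 'I_d) (f : 'rV[R]_d -> R)
    (x : 'rV[R]_d) : R :=
  lim (pd_quot U a f x).

(** f is of class C^r on U, up to the boundary points belonging to U. *)
Fixpoint Ck d (r : nat) (U : set 'rV[R]_d) (f : 'rV[R]_d -> R) : Prop :=
  {within U, continuous f} /\
  match r with
  | 0%N => True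
  | r'.+1 => forall a : 'I_d,
      (forall x, U x -> cvg (pd_quot U a f x)) /\ Ck r' U (pd U a f)
  end.

Definition smooth d (U : set 'rV[R]_d) (f : 'rV[R]_d -> R) : Prop :=
  forall r, Ck r U f.

Definition smooth_map d e (U : set 'rV[R]_d) (f : 'rV[R]_d -> 'rV[R]_e) : Prop :=
  forall b : 'I_e, smooth U (fun x => f x ord0 b).

Definition jac d e (U : set 'rV[R]_d) (f : 'rV[R]_d -> 'rV[R]_e)
    (x : 'rV[R]_d) : 'M[R]_(d, e) :=
  \matrix_(a, b) pd U a (fun y => f y ord0 b) x.

(** Euclidean norm; the library norm of a row vector is the sup norm. *)
Definition enorm d (t : 'rV[R]_d) : R := Num.sqrt (\sum_a t ord0 a ^+ 2).

End Calculus.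

(** Riemannian geometry of a metric G over a coordinate domain U. *)
Section LocalGeometry.
Variables (R : realType) (d : nat).
Variables (U : set 'rV[R]_d) (G : 'rV[R]_d -> 'M[R]_d).

Definition inner (x u v : 'rV[R]_d) : R := (u *m G x *m v^T) ord0 ord0.

Definition grad (f : 'rV[R]_d -> R) (x : 'rV[R]_d) : 'rV[R]_d :=
  (\row_a pd U a f x) *m invmx (G x).

(** [christoffel x a b c] is the symbol with lower indices a, b and upper index
    c of the Levi-Civita connection. *)
Definition christoffel (x : 'rV[R]_d) (a b c : 'I_d) : R :=
  2^-1 * \sum_e invmx (G x) c e *
    (pd U a (fun y => G y b e) x + pd U b (fun y => G y a e) x
     - pd U e (fun y => G y a b) x).

(** Trace of the covariant Hessian. *)
Definition laplacian (u : 'rV[R]_d -> R) (x : 'rV[R]_d) : R :=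
  \sum_a \sum_b invmx (G x) a b *
    (pd U a (pd U b u) x - \sum_c christoffel x a b c * pd U c u x).

Definition weighted_laplacian (w u : 'rV[R]_d -> R) (x : 'rV[R]_d) : R :=
  laplacian u x + inner x (grad w x) (grad u x).

(** Covariant derivative of a vector field X along a map f : W -> U; its a-th
    row is the derivative in the direction of the a-th coordinate of W. *)
Definition covariant_along m (W : set 'rV[R]_m) (f X : 'rV[R]_m -> 'rV[R]_d)
    (x : 'rV[R]_m) : 'M[R]_(m, d) :=
  \matrix_(a, c) (pd W a (fun y => X y ord0 c) x +
    \sum_b \sum_e christoffel (f x) b e c *
      pd W a (fun y => f y ord0 b) x * X x ord0 e).

(** The rows of E form a basis of a subspace T of the tangent space at y and the
    rows of D are the covariant derivatives of a field along these basis
    vectors; this is the trace of the T-component of the covariant derivative. *)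
Definition tangential_div m (y : 'rV[R]_d) (E D : 'M[R]_(m, d)) : R :=
  \tr (invmx (E *m G y *m E^T) *m (D *m G y *m E^T)).

(** psi-mean curvature at y of a hypersurface with tangent basis E and unit
    normal N whose covariant derivatives along E are the rows of D. *)
Definition weighted_mean_curvature m (w : 'rV[R]_d -> R) (y : 'rV[R]_d)
    (E D : 'M[R]_(m, d)) (N : 'rV[R]_d) : R :=
  - tangential_div y E D - inner y (grad w y) N.

End LocalGeometry.

(** Smooth manifolds with (possibly empty) boundary. [chart i] and [chart_inv i]
    are meaningful on [chart_dom i] and on its image only. *)
Record manifold (R : realType) (d : nat) := Manifold {
  carrier :> topologicalType;
  chart_index : Type;
  chart_dom : chart_index -> set carrier;
  chart : chart_index -> carrier -> 'rV[R]_d;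
  chart_inv : chart_index -> 'rV[R]_d -> carrier;
  manifold_hausdorff : hausdorff_space carrier;
  manifold_second_countable : @second_countable carrier;
  chart_dom_open : forall i, open (chart_dom i);
  chart_cover : forall p, exists i, chart_dom i p;
  chart_invK : forall i p, chart_dom i p -> chart_inv i (chart i p) = p;
  chart_im_open : forall i, exists2 O : set 'rV[R]_d,
    open O & chart i @` chart_dom i = O `&` @halfspace R d;
  chart_continuous : forall i, {within chart_dom i, continuous (chart i)};
  chart_inv_continuous : forall i,
    {within chart i @` chart_dom i, continuous (chart_inv i)};
  chart_smooth : forall i j,
    smooth_map (chart i @` (chart_dom i `&` chart_dom j))
               (fun x => chart j (chart_inv i x))
}.

Section ManifoldNotions.
Variables (R : realType) (d : nat) (M : manifold R d).
Implicit Types i j : chart_index M.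

Definition chart_im i : set 'rV[R]_d := chart i @` chart_dom i.

Definition transition i j (x : 'rV[R]_d) : 'rV[R]_d := chart j (chart_inv i x).

Definition transition_jac i j (x : 'rV[R]_d) : 'M[R]_d :=
  jac (chart i @` (chart_dom i `&` chart_dom j)) (transition i j) x.

Definition boundary : set M :=
  [set p | exists2 i, chart_dom i p & @halfspace_boundary R d (chart i p)].

Definition in_chart i (u : M -> R) (x : 'rV[R]_d) : R := u (chart_inv i x).

Definition Ck_on_manifold (r : nat) (u : M -> R) : Prop :=
  forall i, Ck r (chart_im i) (in_chart i u).

(** Existence of a nowhere vanishing continuous d-form. *)
Definition orientable : Prop :=
  exists omega : chart_index M -> 'rV[R]_d -> R,
    (forall i, {within chart_im i, continuous (omega i)}) /\
    (forall i x, chart_im i x -> omega i x != 0) /\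
    (forall i j p, chart_dom i p -> chart_dom j p ->
       omega i (chart i p) =
       \det (transition_jac i j (chart i p)) * omega j (chart j p)).

End ManifoldNotions.

Record riemannian (R : realType) (d : nat) := Riemannian {
  base :> manifold R d;
  metric : chart_index base -> 'rV[R]_d -> 'M[R]_d;
  metric_smooth : forall i a b, smooth (chart_im i) (fun x => metric i x a b);
  metric_sym : forall i x, chart_im i x -> (metric i x)^T = metric i x;
  metric_pos : forall i x (v : 'rV[R]_d),
    chart_im i x -> v != 0 -> 0 < inner (metric i) x v v;
  metric_change : forall i j p, chart_dom i p -> chart_dom j p ->
    metric i (chart i p) =
    transition_jac i j (chart i p) *m metric j (chart j p)
      *m (transition_jac i j (chart i p))^T
}.

(** [v] represents the inner unit conormal at the boundary point [p] in the
    chart [i]. *)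
Definition inner_unit_conormal (R : realType) d (S : riemannian R d)
    (i : chart_index S) (p : S) (v : 'rV[R]_d) : Prop :=
  inner (metric i) (chart i p) v v = 1 /\
  forall a : 'I_d, val a = 0%N ->
    0 < v ord0 a /\
    (forall w : 'rV[R]_d, w ord0 a = 0 -> inner (metric i) (chart i p) v w = 0).

(** [w] is the logarithm of the weight. *)
Definition weighted_parabolic (R : realType) d (S : riemannian R d)
    (w : S -> R) : Prop :=
  forall u : S -> R,
    Ck_on_manifold 2 u ->
    (exists C : R, forall p, u p <= C) ->
    (forall (i : chart_index S) (p : S), chart_dom i p -> ~ boundary p ->
       0 <= weighted_laplacian (chart_im i) (metric i)
              (in_chart i w) (in_chart i u) (chart i p)) ->
    (forall (i : chart_index S) (p : S) (v : 'rV[R]_d),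
       chart_dom i p -> boundary p -> inner_unit_conormal i p v ->
       0 <= \sum_a v ord0 a * pd (chart_im i) a (in_chart i u) (chart i p)) ->
    exists c : R, forall p, u p = c.

(** The Riemannian product M x R^k, in the charts (chart i) x id. *)
Section Product.
Variables (R : realType) (n k : nat) (M : riemannian R n).
Implicit Types (i j : chart_index M) (z : M * 'rV[R]_k).

Definition prod_chart i z : 'rV[R]_(n + k) := row_mx (chart i z.1) z.2.

Definition prod_im i : set 'rV[R]_(n + k) :=
  [set y : 'rV[R]_(n + k) | chart_im i (lsubmx y)].

Definition prod_metric i (y : 'rV[R]_(n + k)) : 'M[R]_(n + k) :=
  block_mx (metric i (lsubmx y)) 0 0 1%:M.

Definition prod_transition_jac i j z : 'M[R]_(n + k) :=
  block_mx (transition_jac i j (chart i z.1)) 0 0 1%:M.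

Definition prod_in_chart i (psi : M * 'rV[R]_k -> R)
    (y : 'rV[R]_(n + k)) : R :=
  psi (chart_inv i (lsubmx y), rsubmx y).

(** The density exp psi is then a positive C^1 function. *)
Definition is_weight (psi : M * 'rV[R]_k -> R) : Prop :=
  forall i, Ck 1 (prod_im i) (prod_in_chart i psi).

(** Tangent hyperplane T_p M + t^perp of M x S^(k-1)(|t|) at (p, t). *)
Definition cylinder_tangent (t : 'rV[R]_k) : 'M[R]_(n + k) :=
  kermx (col_mx (0 : 'M[R]_(n, 1)) t^T).

(** H_(psi,r) at a point z of M x S^(k-1)(r); the unit normal is the restriction
    of the vector field (0, - t / r). *)
Definition cylinder_curvature (psi : M * 'rV[R]_k -> R) (r : R) i z : R :=
  let X := fun y : 'rV[R]_(n + k) =>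
    row_mx (0 : 'rV[R]_n) (- (r^-1 *: rsubmx y)) in
  let y := prod_chart i z in
  let E := row_base (cylinder_tangent z.2) in
  let DX := covariant_along (prod_im i) (prod_metric i) (prod_im i) id X y in
  weighted_mean_curvature (prod_im i) (prod_metric i) (prod_in_chart i psi)
    y E (E *m DX) (X y).

End Product.

(** Immersed hypersurfaces F : S -> M x R^k, where dim S = n + k - 1. *)
Section Hypersurface.
Variables (R : realType) (n k : nat) (M : riemannian R n).
Variables (S : riemannian R (n + k).-1) (F : S -> M * 'rV[R]_k).
Implicit Types (a : chart_index S) (i j : chart_index M) (p : S).

Definition hyp_dom a i : set S :=
  chart_dom a `&` [set p | chart_dom i (F p).1].

Definition hyp_im a i : set 'rV[R]_(n + k).-1 := chart a @` hyp_dom a i.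

Definition hyp_local a i (x : 'rV[R]_(n + k).-1) : 'rV[R]_(n + k) :=
  prod_chart i (F (chart_inv a x)).

(** The rows are a basis of the tangent hyperplane at [F p]. *)
Definition hyp_frame a i p : 'M[R]_((n + k).-1, n + k) :=
  jac (hyp_im a i) (hyp_local a i) (chart a p).

(** As the metric of S is positive definite, F is an immersion; S then carries
    the induced metric. *)
Definition isometric_immersion : Prop :=
  continuous F /\
  (forall a i, smooth_map (hyp_im a i) (hyp_local a i)) /\
  (forall a i p, hyp_dom a i p ->
     metric a (chart a p) =
     hyp_frame a i p *m prod_metric i (prod_chart i (F p))
       *m (hyp_frame a i p)^T).

(** [N i p] is the coordinate vector, in the chart [i], of the normal at [F p]. *)
Definition unit_normal (N : chart_index M -> S -> 'rV[R]_(n + k)) : Prop :=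
  (forall a i, smooth_map (hyp_im a i) (fun x => N i (chart_inv a x))) /\
  (forall i j p, chart_dom i (F p).1 -> chart_dom j (F p).1 ->
     N j p = N i p *m prod_transition_jac i j (F p)) /\
  (forall a i p, hyp_dom a i p ->
     inner (prod_metric i) (prod_chart i (F p)) (N i p) (N i p) = 1 /\
     hyp_frame a i p *m prod_metric i (prod_chart i (F p)) *m (N i p)^T = 0).

Definition hyp_curvature (psi : M * 'rV[R]_k -> R)
    (N : chart_index M -> S -> 'rV[R]_(n + k)) a i p : R :=
  weighted_mean_curvature (prod_im i) (prod_metric i) (prod_in_chart i psi)
    (prod_chart i (F p)) (hyp_frame a i p)
    (covariant_along (prod_im i) (prod_metric i) (hyp_im a i) (hyp_local a i)
       (fun x => N i (chart_inv a x)) (chart a p))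
    (N i p).

Definition tangent_to_cylinder (r : R) : Prop :=
  forall p, boundary p ->
    enorm (F p).2 = r /\
    forall a i, hyp_dom a i p ->
      (hyp_frame a i p == cylinder_tangent n (F p).2)%MS.

End Hypersurface.

(* Main.v *)
Require Import Defs.
From HB Require Import structures.
From mathcomp Require Import all_boot all_order all_algebra.
From mathcomp Require Import all_classical all_reals all_analysis.
From mathcomp Require Import ring lra.
Set Implicit Arguments.
Unset Strict Implicit.
Unset Printing Implicit Defensive.
Import Order.TTheory GRing.Theory Num.Theory numFieldNormedType.Exports.
Local Open Scope classical_set_scope.
Local Open Scope ring_scope.

(** Let [t : Sigma -> R^k] be the Euclidean component of the immersion, [r = |t|]
    and [N_2] the Euclidean component of the unit normal.  The function
    [u = |t|^2 / 2] satisfies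
      [Delta_psi u = k - |N_2|^2 + <grad psi, V> + H_psi <N, V>],  [V = (0, t)].
    Since [k - 1 + <grad psi, V> = r H_(psi,r) >= lambda r], [|N_2| <= 1] and
    [|<N, V>| <= r], this is at least
    [(1 - |N_2|^2) + lambda r - |H_psi| r >= 0].  Tangency to the cylinder makes
    [grad u] vanish on the boundary of [Sigma], so parabolicity forces [u] to be
    constant, equal to its boundary value [r0^2 / 2].  Then [Delta_psi u = 0] and
    all the inequalities above are equalities.

    The formula for [Delta_psi u] is also needed at boundary points, where partial
    derivatives are one-sided; it rests on the chain rule and on the symmetry of
    second derivatives, both valid up to the boundary of a half-space. *)

(** * Calculus on relatively open subsets of an orthant *)

(** No orthonormal frames are used. If the rows of [J] span the tangent space of a hypersurface,
    [g = J G J^T] and [N] is a unit normal row, then [J^T g^-1 J + N^T N = G^-1] ([frame_inverse]).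
    This identity turns traces and gradients on the hypersurface into ambient ones, and it also
    gives the curvature of the cylinders. The energy [u] is the restriction of half the quadratic
    form of the projection [Pi] onto the Euclidean factor. The connection of the product has no
    Euclidean component, so [Pi] is the ambient covariant Hessian of that function, and restriction
    to the hypersurface only adds second fundamental form times [<N, V>]. Where [t = 0] there is no
    cylinder to compare with; but there [V = 0], and [k - |N_2|^2 >= k - 1] is enough. Boundary
    points of the hypersurface cannot be skipped, because the final equality of curvatures is
    claimed there too. *)

Section OrthantCalculus.
Variable R : realType.

(* [P] is the set of coordinates constrained to be nonnegative: [{0}] for a chart
   of a manifold with boundary, empty for the product of a point with R^k. *)
Definition orthant d (P : pred 'I_d) : set 'rV[R]_d :=
  [set x | forall a, P a -> 0 <= x ord0 a].

(** A box, hence compatible with the sup norm of the library. Moving from [x] to [y] one coordinate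
    at a time does not leave it, which [increment] exploits. *)
Definition near_point d (x : 'rV[R]_d) (e : R) (y : 'rV[R]_d) :=
  forall a, `|y ord0 a - x ord0 a| < e.

Definition relatively_open d (P : pred 'I_d) (U : set 'rV[R]_d) : Prop :=
  U `<=` orthant P /\
  forall x, U x -> exists2 e, 0 < e &
    forall y, near_point x e y -> orthant P y -> U y.

Local Notation step x h a := (x + h *: delta_mx ord0 a).

Lemma stepE d (x : 'rV[R]_d) h (a b : 'I_d) :
  (step x h a) ord0 b = x ord0 b + h *+ (b == a).
Proof.
by rewrite !mxE eqxx /= mulr_natr.
Qed.

Lemma near_point_open d (O : set 'rV[R]_d) x : open O -> O x ->
  exists2 e, 0 < e & near_point x e `<=` O.
Proof.
move=> oO Ox; have /nbhs_ballP[e /= e0 eO] : nbhs x O by exact: open_nbhs_nbhs.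
exists e => // y xy; apply: eO; split=> // i j.
by rewrite (ord1 i) /ball /= distrC; exact: xy.
Qed.

Definition continuous_on d (U : set 'rV[R]_d) (f : 'rV[R]_d -> R) : Prop :=
  {within U, continuous f}.

Lemma continuous_withinP d (U : set 'rV[R]_d) (f : 'rV[R]_d -> R) :
  continuous_on U f <->
  forall x, U x -> forall e, 0 < e -> exists2 r, 0 < r &
    forall y, U y -> near_point x r y -> `|f y - f x| < e.
Proof.
split.
- move=> /(@subspace_continuousP _ U _ f) cf x Ux e e0.
  have /cvgrPdist_lt/(_ e e0) := cf x Ux.
  rewrite near_withinE => /nbhs_ballP[r /= r0 rU].
  exists r => // y Uy xy; rewrite distrC; apply: rU => //; split=> // i j.
  by rewrite (ord1 i) /ball /= distrC; exact: xy.
- move=> H; apply/(@subspace_continuousP _ U _ f) => x Ux.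
  apply/cvgrPdist_lt => e e0; have [r r0 rU] := H x Ux e e0.
  rewrite near_withinE; apply/nbhs_ballP; exists r => //= y [_ xy] Uy.
  rewrite distrC; apply: rU => // a.
  by rewrite distrC; exact: xy.
Qed.

Definition is_pd d (U : set 'rV[R]_d) a (f : 'rV[R]_d -> R) x (l : R) : Prop :=
  pd_quot U a f x --> l.

Lemma is_pdP d (U : set 'rV[R]_d) a f x l : is_pd U a f x l <->
  forall e, 0 < e -> exists2 r, 0 < r &
    forall h, h != 0 -> `|h| < r -> U (step x h a) ->
    `|h^-1 * (f (step x h a) - f x) - l| < e.
Proof.
split.
- move=> /cvgrPdist_lt H e e0; have := H e e0.
  rewrite near_withinE => /nbhs_ballP[r /= r0 rU].
  exists r => // h h0 hr Uh; rewrite distrC; apply: rU => //.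
  by rewrite /ball /= sub0r normrN.
- move=> H; apply/cvgrPdist_lt => e e0; have [r r0 rU] := H e e0.
  rewrite near_withinE; apply/nbhs_ballP; exists r => //= h hr h0 Uh.
  rewrite distrC; apply: rU => //.
  by move: hr; rewrite /ball /= sub0r normrN.
Qed.

Lemma orthant_step d (P : pred 'I_d) x h a :
  orthant P x -> 0 <= h -> orthant P (step x h a).
Proof.
by move=> ox h0 b Pb; rewrite stepE addr_ge0 ?ox ?mulrn_wge0.
Qed.

Lemma near_point_step d (x : 'rV[R]_d) h a e :
  `|h| < e -> near_point x e (step x h a).
Proof.
move=> he b; rewrite stepE [_ + _ - _]addrC addKr.
by case: eqP => _ //=; rewrite mulr0n normr0 (le_lt_trans _ he).
Qed.

Lemma step_in d (P : pred 'I_d) U x a : relatively_open P U -> U x ->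
  exists2 e, 0 < e & forall h, 0 <= h -> h < e -> U (step x h a).
Proof.
move=> [UP oU] Ux; have [e e0 eU] := oU x Ux.
exists e => // h h0 he; apply: eU.
  by apply: near_point_step; rewrite ger0_norm.
by apply: orthant_step => //; exact: UP.
Qed.

(** Positive steps never leave the orthant, so arbitrarily small admissible steps exist even at a
    boundary point. Properness makes the limit in [pd] unique. *)
Lemma pd_filter_proper d (P : pred 'I_d) U x a : relatively_open P U -> U x ->
  ProperFilter (within [set h : R | U (step x h a)] (dnbhs (0 : R))).
Proof.
move=> oU Ux; apply: Build_ProperFilter_ex => A.
rewrite /within /= => /nbhs_ballP[r /= r0 rA].
have [e e0 eU] := step_in a oU Ux.
exists (Num.min r e / 2).
have m0 : 0 < Num.min r e by rewrite lt_min r0 e0.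
have mh : Num.min r e / 2 < Num.min r e by lra.
apply: rA.
- rewrite /ball /= sub0r normrN gtr0_norm ?divr_gt0 //.
  by apply: lt_le_trans mh _; rewrite ge_min lexx.
- by rewrite gt_eqF // divr_gt0.
- apply: eU; first by rewrite ltW // divr_gt0.
  by apply: lt_le_trans mh _; rewrite ge_min lexx orbT.
Qed.

Section Fixed.
Variables (d : nat) (P : pred 'I_d) (U : set 'rV[R]_d).
Hypothesis oU : relatively_open P U.

Lemma is_pd_eq a f x l : U x -> is_pd U a f x l -> pd U a f x = l.
Proof.
move=> Ux H.
have FF := pd_filter_proper a oU Ux.
exact: (cvg_lim (@Rhausdorff R) H).
Qed.

Lemma is_pd_cvg a f x : cvg (pd_quot U a f x) <-> is_pd U a f x (pd U a f x).
Proof. by split. Qed.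

Lemma cvg_is_pd a f x l : is_pd U a f x l -> cvg (pd_quot U a f x).
Proof. by move=> H; apply/cvg_ex; exists l. Qed.

Lemma is_pd_cst a c x : is_pd U a (fun=> c) x 0.
Proof.
apply/is_pdP => e e0; exists 1 => // h _ _ _.
by rewrite subrr mulr0 subr0 normr0.
Qed.

Lemma is_pdD a f g x l m : is_pd U a f x l -> is_pd U a g x m ->
  is_pd U a (fun y => f y + g y) x (l + m).
Proof.
move=> Hf Hg; rewrite /is_pd.
apply: cvg_trans (cvgD Hf Hg); apply: near_eq_cvg.
near=> h; rewrite !fctE /=; ring.
Unshelve. all: by end_near. Qed.

Lemma is_pdZ a f x l c : is_pd U a f x l -> is_pd U a (fun y => c * f y) x (c * l).
Proof.
move=> Hf; rewrite /is_pd.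
apply: cvg_trans (cvgM (cvg_cst c) Hf); apply: near_eq_cvg.
near=> h; rewrite ?fctE /=; ring.
Unshelve. all: by end_near. Qed.

Lemma is_pd_sum (I : Type) (s : seq I) a (f : I -> 'rV[R]_d -> R) x l :
  (forall i, is_pd U a (f i) x (l i)) ->
  is_pd U a (fun y => \sum_(i <- s) f i y) x (\sum_(i <- s) l i).
Proof.
move=> H; elim: s => [|i s IH].
  rewrite big_nil; under [X in is_pd _ _ X]eq_fun do rewrite big_nil.
  exact: is_pd_cst.
rewrite big_cons; under [X in is_pd _ _ X]eq_fun do rewrite big_cons.
exact: is_pdD.
Qed.

Lemma is_pd_continuous a f x l : is_pd U a f x l ->
  f (step x h a) @[h --> within [set h : R | U (step x h a)] (dnbhs (0 : R))]
   --> f x.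
Proof.
move=> Hf.
have Hid : (h : R) @[h --> within [set h : R | U (step x h a)] (dnbhs (0 : R))]
    --> (0 : R).
  by apply: cvg_trans (@nbhs_dnbhs _ (0 : R)); exact: cvg_within.
(* The value at the displaced point is [h] times the difference quotient plus [f x]. *)
rewrite -[X in _ --> X](_ : 0 * l + f x = f x); last by rewrite mul0r add0r.
apply: cvg_trans (cvgD (cvgM Hid Hf) (cvg_cst (f x))).
apply: near_eq_cvg.
near=> h; rewrite !fctE /= mulrA mulfV ?mul1r ?subrK //.
near: h; rewrite near_withinE; apply/nbhs_ballP; exists 1 => //=.
Unshelve. all: by end_near. Qed.

Lemma is_pdM a f g x l m : is_pd U a f x l -> is_pd U a g x m ->
  is_pd U a (fun y => f y * g y) x (l * g x + f x * m).
Proof.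
move=> Hf Hg; rewrite /is_pd.
apply: cvg_trans
  (cvgD (cvgM Hf (is_pd_continuous Hg)) (cvgM (cvg_cst (f x)) Hg)).
apply: near_eq_cvg.
near=> h; rewrite ?fctE /=; ring.
Unshelve. all: by end_near. Qed.

End Fixed.

(** Whether a derivative is one-sided is decided by the common orthant: a short step that stays in
    [W] stays in the orthant, hence in [U]. *)
Lemma is_pd_local d (P : pred 'I_d) (U W : set 'rV[R]_d) a f g x l :
  relatively_open P U -> relatively_open P W -> U x -> W x ->
  (forall y, U y -> W y -> f y = g y) -> is_pd U a f x l -> is_pd W a g x l.
Proof.
move=> [UP oU] [WP oW] Ux Wx fg /is_pdP H; apply/is_pdP => e e0.
have [r r0 rU] := H e e0.
have [s s0 sU] := oU _ Ux.
exists (Num.min r s); first by rewrite lt_min r0.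
move=> h h0; rewrite lt_min => /andP[hr hs] Wh.
have Uh : U (step x h a).
  by apply: sU (WP _ Wh); exact: near_point_step.
by rewrite -!fg //; exact: rU.
Qed.

Lemma pd_local d (P : pred 'I_d) (U W : set 'rV[R]_d) a f g x :
  relatively_open P U -> relatively_open P W -> U x -> W x ->
  (forall y, U y -> W y -> f y = g y) -> is_pd U a f x (pd U a f x) ->
  pd W a g x = pd U a f x.
Proof.
move=> oU oW Ux Wx fg H.
exact/(is_pd_eq oW Wx)/(is_pd_local oU oW Ux Wx fg H).
Qed.

Lemma Ck0 d (U : set 'rV[R]_d) r f : Ck r U f -> continuous_on U f.
Proof. by case: r => [|r] []. Qed.

Lemma Ck_pd d (U : set 'rV[R]_d) r f a x : Ck r.+1 U f -> U x ->
  is_pd U a f x (pd U a f x).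
Proof. by move=> [_ /(_ a)[H _]] Ux; apply/is_pd_cvg; exact: H. Qed.

Lemma CkS d (U : set 'rV[R]_d) r f : Ck r.+1 U f -> Ck r U f.
Proof.
elim: r f => [|r IH] f; first by case.
move=> [cf H]; split => // a; have [H1 H2] := H a; split => //; exact: IH.
Qed.

Lemma Ck_dS d (U : set 'rV[R]_d) r f a : Ck r.+1 U f -> Ck r U (pd U a f).
Proof. by move=> [_ /(_ a)[]]. Qed.

Lemma continuous_within_local d (P : pred 'I_d) (U : set 'rV[R]_d)
    (f : 'rV[R]_d -> R) :
  relatively_open P U ->
  (forall x, U x -> exists W (g : 'rV[R]_d -> R), [/\ relatively_open P W, W x,
     forall y, W y -> g y = f y & continuous_on W g]) ->
  continuous_on U f.
Proof.
move=> oU H; apply/continuous_withinP => x /[dup] Ux /H.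
move=> [W [g [[WP oW] Wx gf /continuous_withinP Cg]]] e e0.
have [s s0 sW] := Cg x Wx e e0.
have [t t0 tW] := oW x Wx.
exists (Num.min s t); first by rewrite lt_min s0.
move=> y Uy xy; have Wy : W y.
  apply: tW; last exact: oU.1.
  by move=> b; apply: lt_le_trans (xy b) _; rewrite ge_min lexx orbT.
rewrite -!gf //; apply: sW => // b.
by apply: lt_le_trans (xy b) _; rewrite ge_min lexx.
Qed.

(** The image of a chart of the hypersurface is only covered by pieces that the immersion sends into
    a single chart of [M]; regularity is checked on these pieces. *)
Lemma Ck_local d (P : pred 'I_d) (U : set 'rV[R]_d) r f : relatively_open P U ->
  (forall x, U x -> exists W g, [/\ relatively_open P W, W `<=` U, W x,
     forall y, W y -> g y = f y & Ck r W g]) -> Ck r U f.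
Proof.
move=> oU; have C0 q h : (forall x, U x ->
    exists W g, [/\ relatively_open P W, W `<=` U, W x,
    forall y, W y -> g y = h y & Ck q W g]) -> continuous_on U h.
  move=> H; apply: (continuous_within_local oU) => x /H[W [g [oW _ Wx gh /Ck0 Cg]]].
  by exists W, g.
elim: r f => [|r IH] f H; first by split => //; exact: C0 H.
split; [exact: C0 H|move=> a; split].
- move=> x /[dup] Ux /H[W [g [oW WU Wx gf Cg]]].
  apply: (@cvg_is_pd _ _ _ _ _ (pd W a g x)).
  by apply: (is_pd_local oW oU Wx Ux _ (Ck_pd Cg Wx)) => y Wy _; exact: gf.
- apply: IH => x /[dup] Ux /H[W [g [oW WU Wx gf Cg]]].
  exists W, (pd W a g); split => //; last exact: Ck_dS.
  move=> y Wy; apply/esym; apply: (pd_local oW oU) => //; first exact: WU.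
    by move=> z Wz _; exact: gf.
  exact: Ck_pd Cg Wy.
Qed.

Section CkAlgebra.
Variables (d : nat) (P : pred 'I_d) (U : set 'rV[R]_d).
Hypothesis oU : relatively_open P U.

Lemma Ck_ext r f g : (forall x, U x -> f x = g x) -> Ck r U f -> Ck r U g.
Proof.
move=> fg Cf; apply: (Ck_local oU) => x Ux.
by exists U, f; split.
Qed.

Lemma Ck_by_pd r f (df : 'I_d -> 'rV[R]_d -> R) :
  continuous_on U f ->
  (forall a x, U x -> is_pd U a f x (df a x)) ->
  (forall a, Ck r U (df a)) -> Ck r.+1 U f.
Proof.
move=> cf Hd Cd; split => // a; split.
  by move=> x Ux; apply: cvg_is_pd (Hd a x Ux).
apply: Ck_ext (Cd a) => x Ux; apply/esym/(is_pd_eq oU) => //; exact: Hd.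
Qed.

Lemma continuous_within_cst c : continuous_on U (fun=> c).
Proof.
apply/continuous_withinP => x _ e e0; exists 1 => // y _ _.
by rewrite subrr normr0.
Qed.

Lemma Ck_cst r c : Ck r U (fun=> c).
Proof.
elim: r c => [|r IH] c; first by split=> //; exact: continuous_within_cst.
apply: (@Ck_by_pd _ _ (fun _ _ => 0)) => //.
  exact: continuous_within_cst.
by move=> a x _; exact: is_pd_cst.
Qed.

Lemma continuous_withinD (f g : 'rV[R]_d -> R) : continuous_on U f ->
  continuous_on U g -> continuous_on U (fun x => f x + g x).
Proof.
move=> /(@subspace_continuousP _ U _ f) cf /(@subspace_continuousP _ U _ g) cg.
apply/(@subspace_continuousP _ U _ (fun x => f x + g x)) => x Ux.
exact: cvgD (cf x Ux) (cg x Ux).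
Qed.

Lemma continuous_withinM (f g : 'rV[R]_d -> R) : continuous_on U f ->
  continuous_on U g -> continuous_on U (fun x => f x * g x).
Proof.
move=> /(@subspace_continuousP _ U _ f) cf /(@subspace_continuousP _ U _ g) cg.
apply/(@subspace_continuousP _ U _ (fun x => f x * g x)) => x Ux.
exact: cvgM (cf x Ux) (cg x Ux).
Qed.

Lemma CkD r f g : Ck r U f -> Ck r U g -> Ck r U (fun x => f x + g x).
Proof.
elim: r f g => [|r IH] f g Cf Cg.
  by split => //; apply: (continuous_withinD (Ck0 Cf) (Ck0 Cg)).
apply: (@Ck_by_pd _ _ (fun a x => pd U a f x + pd U a g x)).
- by apply: (continuous_withinD (Ck0 Cf) (Ck0 Cg)).
- by move=> a x Ux; apply: (is_pdD (Ck_pd Cf Ux) (Ck_pd Cg Ux)).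
- by move=> a; apply: IH; exact: Ck_dS.
Qed.

Lemma CkM r f g : Ck r U f -> Ck r U g -> Ck r U (fun x => f x * g x).
Proof.
elim: r f g => [|r IH] f g Cf Cg.
  by split => //; apply: (continuous_withinM (Ck0 Cf) (Ck0 Cg)).
apply: (@Ck_by_pd _ _ (fun a x => pd U a f x * g x + f x * pd U a g x)).
- by apply: (continuous_withinM (Ck0 Cf) (Ck0 Cg)).
- by move=> a x Ux; apply: (is_pdM (Ck_pd Cf Ux) (Ck_pd Cg Ux)).
- by move=> a; apply: CkD; apply: IH; by [exact: Ck_dS|exact: CkS].
Qed.

Lemma Ck_sum r (I : Type) (s : seq I) (f : I -> 'rV[R]_d -> R) :
  (forall i, Ck r U (f i)) -> Ck r U (fun x => \sum_(i <- s) f i x).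
Proof.
move=> H; elim: s => [|i s IH].
  by under eq_fun do rewrite big_nil; exact: Ck_cst.
by under eq_fun do rewrite big_cons; exact: CkD.
Qed.

End CkAlgebra.
End OrthantCalculus.

(** * Mean value theorem and symmetry of second derivatives, up to the boundary *)

Section MeanValue.
Variable R : realType.
Local Notation step x h a := (x + h *: delta_mx ord0 a).

(** One-sided at the end points [0] and [T]. *)
Definition derivative_on (T : R) (phi dphi : R -> R) : Prop :=
  forall s, 0 <= s <= T -> forall e, 0 < e -> exists2 r, 0 < r &
    forall h, h != 0 -> `|h| < r -> 0 <= s + h <= T ->
    `|h^-1 * (phi (s + h) - phi s) - dphi s| < e.

Lemma derivative_on_continuous T phi dphi : derivative_on T phi dphi ->
  {within `[0, T], continuous phi}.
Proof.
move=> H; apply/(@subspace_continuousP _ `[0, T]%classic _ phi) => s.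
rewrite /= in_itv /= => sT; apply/cvgrPdist_lt => e e0.
(* Error 1 bounds the quotient by [|dphi s| + 1], which is a Lipschitz estimate at [s]. *)
have [r r0 rH] := H s sT 1 ltr01.
have k0 : 0 < `|dphi s| + 1 by rewrite ltr_wpDl.
rewrite near_withinE; apply/nbhs_ballP.
exists (Num.min r (e / (`|dphi s| + 1))) => /=.
  by rewrite lt_min r0 divr_gt0.
move=> t; rewrite /ball /= lt_min => /andP[str ste]; rewrite in_itv /= => tT.
have [->|ts] := eqVneq t s; first by rewrite subrr normr0.
have h0 : t - s != 0 by rewrite subr_eq0.
have := rH (t - s) h0; rewrite distrC => /(_ str).
rewrite [s + _]addrC subrK => /(_ tT) Hq.
have : `|(t - s)^-1 * (phi t - phi s)| < `|dphi s| + 1.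
  rewrite -[X in `|X|](subrK (dphi s)) (le_lt_trans (ler_normD _ _)) //.
  by rewrite addrC ltrD2l.
rewrite normrM normfV => Hq2.
have hp : 0 < `|t - s| by rewrite normr_gt0.
rewrite distrC -(mulVKf (lt0r_neq0 hp) `|phi t - phi s|).
apply: (@le_lt_trans _ _ (`|t - s| * (`|dphi s| + 1))).
  by rewrite ler_wpM2l // ltW.
by rewrite -ltr_pdivlMr // distrC.
Qed.

Lemma mean_value T phi dphi : 0 < T -> derivative_on T phi dphi ->
  exists2 c, 0 <= c <= T & phi T - phi 0 = T * dphi c.
Proof.
move=> T0 H.
have D s : s \in `]0, T[ -> is_derive s 1 phi (dphi s).
  rewrite in_itv /= => /andP[s0 sT].
  have C : h^-1 *: ((phi \o shift s) (h *: (1 : R)) - phi s)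
      @[h --> (0 : R)^'] --> dphi s.
    apply/cvgrPdist_lt => e e0.
    have [|r r0 rH] := H s _ e e0; first by rewrite !ltW.
    apply/nbhs_ballP; exists (Num.min r (Num.min s (T - s))) => /=.
      by rewrite !lt_min r0 s0 subr_gt0.
    move=> h; rewrite /ball /= sub0r normrN !lt_min => /and3P[hr hs hT] h0.
    rewrite distrC [_ *: 1]mulr1 [h + s]addrC; apply: rH => //.
    by move: hs hT; rewrite !ltr_norml => /andP[? ?] /andP[? ?]; lra.
  apply: DeriveDef; first by apply/cvg_ex; exists (dphi s).
  exact: (cvg_lim (@Rhausdorff R) C).
have [c + ->] := MVT T0 D (derivative_on_continuous H).
rewrite in_itv /= => /andP[c0 cT]; exists c; first by rewrite !ltW.
by rewrite subr0 mulrC.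
Qed.

Lemma derivative_onB T phi psi dphi dpsi : derivative_on T phi dphi ->
  derivative_on T psi dpsi ->
  derivative_on T (fun s => phi s - psi s) (fun s => dphi s - dpsi s).
Proof.
move=> H1 H2 s sT e e0; have e20 : 0 < e / 2 by rewrite divr_gt0.
have [r1 r10 r1H] := H1 s sT _ e20; have [r2 r20 r2H] := H2 s sT _ e20.
exists (Num.min r1 r2); first by rewrite lt_min r10.
move=> h h0; rewrite lt_min => /andP[hr1 hr2] shT.
have := r1H h h0 hr1 shT; have := r2H h h0 hr2 shT.
set q2 := _ - dpsi s; set q1 := _ - dphi s => B2 B1.
rewrite (_ : _ - (dphi s - dpsi s) = q1 - q2); last by rewrite /q1 /q2; ring.
by rewrite (le_lt_trans (ler_normB _ _)) //; lra.
Qed.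

Lemma derivative_on_line d (U : set 'rV[R]_d) a f x T (df : R -> R) :
  (forall s, 0 <= s <= T -> U (step x s a) /\ is_pd U a f (step x s a) (df s)) ->
  derivative_on T (fun s => f (step x s a)) df.
Proof.
move=> H s sT e e0; have [Us /is_pdP/(_ e e0)[r r0 rH]] := H s sT.
exists r => // h h0 hr shT.
have E : step (step x s a) h a = step x (s + h) a by rewrite scalerDl addrA.
by rewrite -E; apply: rH => //; rewrite E; have [] := H _ shT.
Qed.

Section Domain.
Variables (d : nat) (P : pred 'I_d) (U : set 'rV[R]_d).
Hypothesis oU : relatively_open P U.

Lemma near_pointW (x y : 'rV[R]_d) e e' :
  e <= e' -> near_point x e y -> near_point x e' y.
Proof. by move=> ee' H b; exact: lt_le_trans (H b) ee'. Qed.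

Lemma step0 (x : 'rV[R]_d) a : step x 0 a = x.
Proof. by rewrite scale0r addr0. Qed.

Lemma near_point_step2 (x : 'rV[R]_d) a b s t e : 0 <= s -> 0 <= t ->
  s + t < e -> near_point x e (step (step x s a) t b).
Proof.
move=> s0 t0 ste c; rewrite !stepE.
set p := s *+ _; set q := t *+ _; rewrite (_ : _ - _ = p + q); last by ring.
apply: le_lt_trans ste; rewrite {}/p {}/q ger0_norm; last by rewrite addr_ge0 ?mulrn_wge0.
by apply: lerD; case: eqP => _ //; rewrite mulr0n.
Qed.

(* Only the points [x + t e_a + u e_b] with [t, u >= 0] are used: they satisfy the
   constraints of the orthant even if [x] is on its boundary. *)
Lemma second_difference f a b x (s : R) : Ck 2 U f -> U x -> 0 < s ->
  (forall t u : R, 0 <= t <= s -> 0 <= u <= s -> U (step (step x t a) u b)) ->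
  exists t u : R, [/\ 0 <= t <= s, 0 <= u <= s &
    f (step (step x s a) s b) - f (step x s a) - f (step x s b) + f x =
    s ^+ 2 * pd U b (pd U a f) (step (step x t a) u b)].
Proof.
move=> Cf Ux s0 HU.
have ss : 0 <= s <= s by rewrite lexx ltW.
have zs : 0 <= (0 : R) <= s by apply/andP; split => //; exact: ltW.
have L u : 0 <= u <= s -> derivative_on s (fun t => f (step (step x t a) u b))
    (fun t => pd U a f (step (step x t a) u b)).
  move=> us; have E t : step (step x t a) u b = step (step x u b) t a.
    by rewrite -!addrA [X in _ + X]addrC.
  have EG g : (fun t => g (step (step x t a) u b)) =
      (fun t => g (step (step x u b) t a)) :> (R -> R).
    by apply/funext => t; rewrite E.
  rewrite !EG.
  apply: (@derivative_on_line _ U a f) => t ts.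
  have Ut : U (step (step x u b) t a) by rewrite -E; exact: HU.
  by split => //; apply: (Ck_pd (CkS Cf) Ut).
(* The second difference is the increment in the direction [a] of the difference of [f] on two
   parallel segments; a second mean value in the direction [b] then treats [pd U a f]. *)
have [t ts Et] := mean_value s0 (derivative_onB (L s ss) (L 0 zs)).
have D : derivative_on s (fun u => pd U a f (step (step x t a) u b))
    (fun u => pd U b (pd U a f) (step (step x t a) u b)).
  apply: (@derivative_on_line _ U b (pd U a f)) => u us.
  have Ut := HU t u ts us; by split => //; apply: (Ck_pd (Ck_dS a Cf) Ut).
have [u us Eu] := mean_value s0 D.
exists t, u; split => //.
move: Et Eu; rewrite !step0 => Et Eu.
rewrite expr2 -mulrA -Eu -Et; ring.
Qed.

(** The second difference is symmetric in [a] and [b], so the two mixed derivatives take a common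
    value at two points as near to [x] as desired; continuity then forbids a gap [e > 0] at [x]. *)
Lemma pd_comm f a b x : Ck 2 U f -> U x -> pd U a (pd U b f) x = pd U b (pd U a f) x.
Proof.
move=> Cf Ux; apply/eqP; rewrite -subr_eq0 -normr_eq0 eq_le normr_ge0 andbT.
rewrite leNgt; apply/negP => e0.
set g1 := pd U a _ in e0 *; set g2 := pd U b _ in e0 *.
set e := `|g1 x - g2 x| in e0.
have e20 : 0 < e / 2 by rewrite divr_gt0.
have C1 : continuous_on U g1 by exact: Ck0 (Ck_dS a (Ck_dS b Cf)).
have C2 : continuous_on U g2 by exact: Ck0 (Ck_dS b (Ck_dS a Cf)).
have /continuous_withinP/(_ x Ux _ e20)[r1 r10 H1] := C1.
have /continuous_withinP/(_ x Ux _ e20)[r2 r20 H2] := C2.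
have [UP /(_ x Ux)[r3 r30 H3]] := oU.
set m := Num.min r1 (Num.min r2 r3).
have m0 : 0 < m by rewrite !lt_min r10 r20.
have [m1 m2 m3] : [/\ m <= r1, m <= r2 & m <= r3].
  by split; rewrite /m !ge_min lexx ?orbT.
(* Two steps of length at most [m / 3] add up to less than [m]. *)
pose s := m / 3; have s0 : 0 < s by rewrite divr_gt0.
have Hn i j t u : 0 <= t <= s -> 0 <= u <= s ->
    near_point x m (step (step x t i) u j).
  move=> /andP[t0 ts] /andP[u0 us]; apply: near_point_step2 => //.
  by move: ts us m0; rewrite /s; lra.
have HU i j t u : 0 <= t <= s -> 0 <= u <= s -> U (step (step x t i) u j).
  move=> ts us; apply: H3; first exact: near_pointW (Hn _ _ _ _ ts us).
  have [/andP[t0 _] /andP[u0 _]] := (ts, us).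
  by do 2 apply: orthant_step => //; exact: UP.
have [t [u [ts us E2]]] := second_difference Cf Ux s0 (HU a b).
have [t' [u' [ts' us' E1]]] := second_difference Cf Ux s0 (HU b a).
have E : g2 (step (step x t a) u b) = g1 (step (step x t' b) u' a).
  apply: (@mulfI _ (s ^+ 2)); first by rewrite expf_neq0 // gt_eqF.
  apply: etrans (esym E2) (etrans _ E1).
  have -> : step (step x s a) s b = step (step x s b) s a.
    by rewrite -!addrA [X in _ + X]addrC.
  by clear; ring.
have B2 := H2 _ (HU a b t u ts us) (near_pointW m2 (Hn a b t u ts us)).
have B1 := H1 _ (HU b a t' u' ts' us') (near_pointW m1 (Hn b a t' u' ts' us')).
have Ee : e = `|g1 x - g2 x| by [].
clearbody e g1 g2; rewrite E in B2; move: (g1 (step _ _ _)) B1 B2 => y B1 B2.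
have := ler_distD y (g1 x) (g2 x); rewrite -Ee [X in X + _]distrC.
by move: B1 B2 e0; clear; lra.
Qed.

End Domain.
End MeanValue.

(** * First-order expansion and chain rule, up to the boundary *)

Section ChainRule.
Variable R : realType.
Local Notation step x h a := (x + h *: delta_mx ord0 a).

Lemma uniform_radius d (Q : 'I_d -> R -> Prop) :
  (forall i r r', r' <= r -> Q i r -> Q i r') ->
  (forall i, exists2 r, 0 < r & Q i r) -> exists2 r, 0 < r & forall i, Q i r.
Proof.
move=> Qle H.
have /choice[r rH] : forall i, exists r, 0 < r /\ Q i r.
  by move=> i; have [r r0 Qr] := H i; exists r.
exists (\big[Num.min/1]_i r i).
  apply: (big_ind (fun z : R => 0 < z)) => // [x y x0 y0|i _].
    by rewrite lt_min x0.
  by have [] := rH i.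
by move=> i; exact: (Qle i (r i) _ (bigmin_le _ _ _) (rH i).2).
Qed.

Section Domain.
Variables (d : nat) (P : pred 'I_d) (U : set 'rV[R]_d).
Hypothesis oU : relatively_open P U.

(** The mean value theorem for an increment of either sign: [|s| <= |T|] with [0 <= s * T] says that
    [s] lies between 0 and [T]. *)
Lemma line_increment f b z (T : R) : Ck 1 U f ->
  (forall s : R, `|s| <= `|T| -> 0 <= s * T -> U (step z s b)) ->
  exists s : R, [/\ `|s| <= `|T|, 0 <= s * T &
    f (step z T b) - f z = T * pd U b f (step z s b)].
Proof.
move=> Cf HU; have [T0|T0|T0] := ltgtP T 0.
(* A negative segment is run from its other end, since [mean_value] is stated on an interval
   starting at 0. *)
- pose z' := step z T b.
  have E s : step z' s b = step z (T + s) b by rewrite scalerDl addrA.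
  have NT0 : 0 < - T by rewrite oppr_gt0.
  have B s : 0 <= s <= - T -> `|T + s| <= `|T| /\ 0 <= (T + s) * T.
    move=> /andP[s0 sT]; rewrite (ltr0_norm T0) ler0_norm; last by lra.
    by split; [lra|rewrite nmulr_lge0 //; lra].
  have D : derivative_on (- T) (fun s => f (step z' s b))
      (fun s => pd U b f (step z' s b)).
    apply: (@derivative_on_line _ _ U b f) => s /B[s1 s2].
    have Us : U (step z' s b) by rewrite E; exact: HU.
    by split => //; apply: (Ck_pd Cf Us).
  have [c /B[c1 c2]] := mean_value NT0 D.
  rewrite !E subrr addr0 scale0r addr0 => Ec; exists (T + c); split => //.
  by apply: oppr_inj; rewrite opprB Ec mulNr.
- have B s : 0 <= s <= T -> `|s| <= `|T| /\ 0 <= s * T.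
    move=> /andP[s0 sT]; rewrite (gtr0_norm T0) ger0_norm //.
    by split => //; rewrite mulr_ge0 // ltW.
  have D : derivative_on T (fun s => f (step z s b))
      (fun s => pd U b f (step z s b)).
    apply: (@derivative_on_line _ _ U b f) => s /B[s1 s2].
    have Us : U (step z s b) by exact: HU.
    by split => //; apply: (Ck_pd Cf Us).
  have [c /B[c1 c2]] := mean_value T0 D.
  by rewrite step0 => Ec; exists c.
- by exists 0; split; rewrite ?T0 ?mul0r ?normr0 ?step0 ?subrr.
Qed.

(** Differentiability from continuous partial derivatives. The straight segment is replaced by a
    broken line parallel to the axes, on which only partial derivatives occur. *)
Lemma increment f y (e : R) : Ck 1 U f -> U y -> 0 < e ->
  exists2 r, 0 < r & forall y', U y' -> near_point y r y' ->
    `|f y' - f y - \sum_b (y' ord0 b - y ord0 b) * pd U b f y| <=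
    e * \sum_b `|y' ord0 b - y ord0 b|.
Proof.
move=> Cf Uy e0.
have [r1 r10 H1] : exists2 r, 0 < r & forall b y', U y' -> near_point y r y' ->
    `|pd U b f y' - pd U b f y| < e.
  apply: (@uniform_radius _ (fun b r => forall y', U y' -> near_point y r y' ->
      `|pd U b f y' - pd U b f y| < e)).
    by move=> b r r' rr' H y' Uy' /(near_pointW rr'); exact: H.
  by move=> b; have /continuous_withinP/(_ y Uy e e0) := Ck0 (Ck_dS b Cf).
have [UP /(_ y Uy)[r2 r20 H2]] := oU.
exists (Num.min r1 r2); first by rewrite lt_min r10.
move=> y' Uy' yy'; set r := Num.min r1 r2 in yy'.
have [rr1 rr2] : r <= r1 /\ r <= r2 by rewrite /r !ge_min !lexx orbT.
(* The vertices of the broken line. All its points have each coordinate between those of [y] and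
   [y'], so they satisfy the constraints of the orthant and stay in the box. *)
pose path j : 'rV[R]_d := \row_b (if (b < j)%N then y' ord0 b else y ord0 b).
pose T (b : 'I_d) := y' ord0 b - y ord0 b.
have path0 : path 0%N = y by apply/rowP => b; rewrite mxE.
have pathd : path d = y' by apply/rowP => b; rewrite mxE ltn_ord.
have pathS (j : 'I_d) : path j.+1 = step (path j) (T j) j.
  apply/rowP => b; rewrite stepE /path !mxE ltnS leq_eqVlt.
  case: (eqVneq b j) => [->|bj] /=; first by rewrite eqxx ltnn /= /T addrC subrK.
  by rewrite -val_eqE in bj; rewrite (negbTE bj) addr0.
have pathU (j : 'I_d) s : `|s| <= `|T j| -> 0 <= s * T j ->
    U (step (path j) s j) /\ near_point y r (step (path j) s j).
  move=> sT sT0; have N : near_point y r (step (path j) s j).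
    move=> b; rewrite stepE /path mxE; case: (eqVneq b j) => [->|bj] /=.
      by rewrite ltnn addrC addKr (le_lt_trans sT) //; exact: yy'.
    rewrite mulr0n addr0; case: ifP => _ //.
    by rewrite subrr normr0 lt_min r10.
  split => //; apply: H2; first exact: near_pointW N.
  move=> b Pb; rewrite stepE /path mxE.
  have [y0 y'0] := (UP _ Uy b Pb, UP _ Uy' b Pb).
  case: (eqVneq b j) => [bj|bj] /=; last by rewrite addr0; case: ifP.
  rewrite bj ltnn mulr1n; move: y0 y'0 sT sT0; rewrite bj /T.
  set p := y ord0 j; set q := y' ord0 j => p0 q0.
  (* If [s < 0] then [T j <= s], so the moved coordinate is at least [q], which is nonnegative. *)
  have [s0|s0] := leP 0 s; first by move=> _ _; rewrite addr_ge0.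
  rewrite nmulr_rge0 // => sT sT0; move: sT.
  by rewrite ltr0_norm // ler0_norm //; lra.
have -> : f y' - f y = \sum_(j < d) (f (path j.+1) - f (path j)).
  by rewrite -(big_mkord xpredT (fun j => f (path j.+1) - f (path j)))
    telescope_sumr // pathd path0.
rewrite -sumrB mulr_sumr; apply: le_trans (ler_norm_sum _ _ _) _.
apply: ler_sum => j _.
have [s [s1 s2]] := line_increment Cf (fun s h1 h2 => (pathU j s h1 h2).1).
rewrite pathS => ->; rewrite -mulrBr normrM mulrC ler_wpM2r //.
have [Us Ns] := pathU j s s1 s2.
by apply/ltW/H1 => //; exact: near_pointW Ns.
Qed.

Lemma is_pd_comp m (W : set 'rV[R]_m) a (f : 'rV[R]_m -> 'rV[R]_d) h x
    (J : 'I_d -> R) :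
  Ck 1 U h -> (forall y, W y -> U (f y)) -> W x ->
  (forall b, is_pd W a (fun y => f y ord0 b) x (J b)) ->
  is_pd W a (fun y => h (f y)) x (\sum_b J b * pd U b h (f x)).
Proof.
move=> Ch fU Wx HJ; apply/is_pdP => e e0.
set D := fun b => pd U b h (f x).
(* [L] will bound the sum of the difference quotients of [f], and [K] weighs their errors. Each of
   the two error terms below is less than [e / 2]; the [+ 1] in the denominators avoids division by
   0. *)
pose L : R := \sum_b (`|J b| + 1); pose K : R := \sum_b `|D b|.
have L0 : 0 <= L by apply: sumr_ge0 => b _; rewrite addr_ge0.
have K0 : 0 <= K by exact: sumr_ge0.
have LS b : `|J b| + 1 <= L.
  rewrite /L (bigD1 b) //= lerDl; apply: sumr_ge0 => c _; exact: addr_ge0.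
have L1 : 0 < 2 * (L + 1) by lra.
have K1 : 0 < 2 * (K + 1) by lra.
have eL0 : 0 < e / (2 * (L + 1)) by rewrite divr_gt0.
have eK0 : 0 < e / (2 * (K + 1)) by rewrite divr_gt0.
have [r r0 Hr] := increment Ch (fU x Wx) eL0.
pose ek := Num.min 1 (e / (2 * (K + 1))).
have ek0 : 0 < ek by rewrite lt_min ltr01.
have [t t0 Ht] : exists2 t, 0 < t & forall b h, h != 0 -> `|h| < t ->
    W (step x h a) ->
    `|h^-1 * (f (step x h a) ord0 b - f x ord0 b) - J b| < ek.
  apply: (@uniform_radius _ (fun b t => forall h, h != 0 -> `|h| < t ->
    W (step x h a) ->
    `|h^-1 * (f (step x h a) ord0 b - f x ord0 b) - J b| < ek)).
    by move=> b r1 r2 rr H u u0 /lt_le_trans/(_ rr); exact: H.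
  by move=> b; have /is_pdP/(_ ek ek0) := HJ b.
(* The second bound keeps the displacement of [f], at most [|u| * L] in each coordinate, within the
   radius [r] of the expansion of [h]. *)
exists (Num.min t (r / (L + 1))).
  by rewrite lt_min t0 divr_gt0 // ltr_wpDl.
move=> u u0; rewrite lt_min => /andP[ut ur] Wu.
set q := fun b => u^-1 * (f (step x u a) ord0 b - f x ord0 b).
have Hq b : `|q b - J b| < ek by exact: Ht.
have Hq1 b : `|q b| <= `|J b| + 1.
  rewrite -[q b](subrK (J b)) (le_trans (ler_normD _ _)) // addrC lerD2l.
  by apply: ltW; apply: lt_le_trans (Hq b) _; rewrite ge_min lexx.
have un : 0 < `|u| by rewrite normr_gt0.
have Eq b : f (step x u a) ord0 b - f x ord0 b = u * q b.
  by rewrite /q mulVKf.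
have N : near_point (f x) r (f (step x u a)).
  move=> b; rewrite Eq normrM; apply: (@le_lt_trans _ _ (`|u| * (L + 1))).
    apply: ler_wpM2l => //; apply: le_trans (Hq1 b) _.
    by apply: le_trans (LS b) _; rewrite lerDl.
  by rewrite -ltr_pdivlMr // ltr_wpDl.
have := Hr _ (fU _ Wu) N; rewrite -/D.
under eq_bigr do rewrite Eq -mulrA.
under [in X in _ <= X -> _]eq_bigr do rewrite Eq normrM.
rewrite -!mulr_sumr => B.
(* The error splits into the remainder in the expansion of [h] and the errors of the difference
   quotients of [f]. *)
rewrite (_ : _ - \sum_b J b * D b =
  u^-1 * (h (f (step x u a)) - h (f x) - u * \sum_b q b * D b) +
  \sum_b (q b - J b) * D b); last first.
  rewrite [in RHS]mulrBr mulKf // -[RHS]addrA; congr (_ + _).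
  by rewrite -sumrN -sumrN -big_split; apply: eq_bigr => b _ /=; ring.
have B1 : `|u^-1 * (h (f (step x u a)) - h (f x) - u * \sum_b q b * D b)| <=
    e / (2 * (L + 1)) * L.
  rewrite normrM normfV -(ler_pM2l un) mulVKf ?gt_eqF //.
  apply: le_trans B _; rewrite [leRHS]mulrCA (ler_wpM2l (ltW eL0)) //.
  by rewrite (ler_wpM2l (ltW un)) //; apply: ler_sum => b _; exact: Hq1.
have B2 : `|\sum_b (q b - J b) * D b| <= e / (2 * (K + 1)) * K.
  apply: le_trans (ler_norm_sum _ _ _) _; rewrite mulr_sumr.
  apply: ler_sum => b _; rewrite normrM ler_wpM2r //.
  by apply: ltW; apply: lt_le_trans (Hq b) _; rewrite ge_min lexx orbT.
have half (z : R) : 0 <= z -> e / (2 * (z + 1)) * z < e / 2.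
  move=> z0; rewrite mulrAC ltr_pdivrMr; last by lra.
  by rewrite (_ : e / 2 * _ = e * (z + 1)); [rewrite ltr_pM2l //; lra|field].
by have := ler_normD (u^-1 * (h (f (step x u a)) - h (f x) - u * \sum_b q b * D b))
  (\sum_b (q b - J b) * D b); have := half L L0; have := half K K0; lra.
Qed.

End Domain.
End ChainRule.

(** * Metrics and connections in coordinates *)

Section LinearAlgebra.
Variable F : realFieldType.

Lemma posdef_unitmx d (G : 'M[F]_d) :
  (forall v : 'rV[F]_d, v != 0 -> 0 < (v *m G *m v^T) ord0 ord0) -> G \in unitmx.
Proof.
move=> Gpos; rewrite -row_free_unit -kermx_eq0; apply/rowV0P => v /sub_kermxP vG.
apply/eqP/negPn/negP => /Gpos.
by rewrite vG mul0mx mxE ltxx.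
Qed.

Lemma gram_unitmx m d (G : 'M[F]_d) (E : 'M[F]_(m, d)) :
  (forall v : 'rV[F]_d, v != 0 -> 0 < (v *m G *m v^T) ord0 ord0) ->
  row_free E -> E *m G *m E^T \in unitmx.
Proof.
move=> Gpos Efree; apply: posdef_unitmx => v v0.
rewrite !mulmxA -[v *m E *m G *m E^T *m _]mulmxA -trmx_mul; apply: Gpos.
by rewrite mulmx_free_eq0.
Qed.

(** The rows of [E] with [nu] form a basis [C]. Orthogonality gives [C G K = C] for the left-hand
    side [K], and [C] can be cancelled. *)
Lemma frame_inverse m d (G : 'M[F]_d) (E : 'M[F]_(m, d)) (nu : 'rV[F]_d) :
  m.+1 = d -> G^T = G -> E *m G *m E^T \in unitmx -> E *m G *m nu^T = 0 ->
  nu *m G *m nu^T = 1%:M ->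
  E^T *m invmx (E *m G *m E^T) *m E + nu^T *m nu = invmx G.
Proof.
move=> md Gs Eu En nn; set g := E *m G *m E^T in Eu *.
have nE : nu *m G *m E^T = 0.
  by apply: trmx_inj; rewrite trmx0 -En !trmx_mul trmxK Gs mulmxA.
set K := _ + _; pose C := col_mx E nu.
have CGK : C *m (G *m K) = C.
  rewrite mul_col_mx /K !mulmxDr !mulmxA -/g En nE nn !mul0mx mulmxV //.
  by rewrite !mul1mx addr0 add0r.
have Cfree : row_free C.
  apply/row_freeP; exists (row_mx (G *m E^T *m invmx g) (G *m nu^T)).
  rewrite mul_col_row !mulmxA -/g En nE nn mul0mx mulmxV //.
  by rewrite -scalar_mx_block.
have Cfull : row_full C by rewrite /row_full (eqP Cfree) addn1 md.
have [B BC] := row_fullP Cfull.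
have GK : G *m K = 1%:M by rewrite -[LHS]mul1mx -BC -mulmxA CGK BC.
have [Gu _] := mulmx1_unit GK.
by rewrite -[K]mul1mx -(mulVmx Gu) -mulmxA GK mulmx1.
Qed.

Lemma mulmx_entry p q d (A : 'M[F]_(p, d)) (G : 'M[F]_d) (C : 'M[F]_(q, d)) i j :
  (A *m G *m C^T) i j = (row i A *m G *m (row j C)^T) ord0 ord0.
Proof.
rewrite -row_mul tr_row !mxE; apply: eq_bigr => k _.
by rewrite !mxE.
Qed.

End LinearAlgebra.

Section MatrixDerivative.
Variables (R : realType) (m : nat) (W : set 'rV[R]_m).

Definition is_mpd p q a (A : 'rV[R]_m -> 'M[R]_(p, q)) x (dA : 'M[R]_(p, q)) :=
  forall i j, is_pd W a (fun y => A y i j) x (dA i j).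

Lemma is_mpdM p q r a (A : 'rV[R]_m -> 'M[R]_(p, q)) (B : 'rV[R]_m -> 'M[R]_(q, r))
    x dA dB : is_mpd a A x dA -> is_mpd a B x dB ->
  is_mpd a (fun y => A y *m B y) x (dA *m B x + A x *m dB).
Proof.
move=> HA HB i j; rewrite mxE !mxE -big_split /=.
rewrite (_ : (fun y => (A y *m B y) i j) = (fun y => \sum_k A y i k * B y k j)).
  by apply: is_pd_sum => k; apply: is_pdM; [exact: HA|exact: HB].
by apply/funext => y; rewrite mxE.
Qed.

Lemma is_mpd_tr p q a (A : 'rV[R]_m -> 'M[R]_(p, q)) x dA :
  is_mpd a A x dA -> is_mpd a (fun y => (A y)^T) x dA^T.
Proof.
move=> HA i j; rewrite mxE.
rewrite (_ : (fun y => (A y)^T i j) = (fun y => A y j i)); first exact: HA.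
by apply/funext => y; rewrite mxE.
Qed.

Lemma is_mpd_cst p q a (A : 'M[R]_(p, q)) x : is_mpd a (fun=> A) x 0.
Proof. by move=> i j; rewrite mxE; exact: is_pd_cst. Qed.

End MatrixDerivative.

Section Christoffel.
Variables (R : realType) (d : nat) (U : set 'rV[R]_d) (G : 'rV[R]_d -> 'M[R]_d).
Variable y : 'rV[R]_d.

Definition metric_pd (b : 'I_d) : 'M[R]_d :=
  \matrix_(i, j) pd U b (fun z => G z i j) y.

Definition metric_dir (X : 'rV[R]_d) : 'M[R]_d := \sum_b X ord0 b *: metric_pd b.

(** The zeroth-order part of the covariant derivative: what remains of it for fields with constant
    coefficients. *)
Definition connection (X Y : 'rV[R]_d) : 'rV[R]_d :=
  \row_c \sum_b \sum_e christoffel U G y b e c * X ord0 b * Y ord0 e.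

Lemma metric_dirE (X Y Z : 'rV[R]_d) : (Y *m metric_dir X *m Z^T) ord0 ord0 =
  \sum_b \sum_e \sum_c X ord0 b * Y ord0 e * Z ord0 c * metric_pd b e c.
Proof.
rewrite mulmx_sumr mulmx_suml summxE; apply: eq_bigr => b _.
rewrite -scalemxAr -scalemxAl !mxE mulr_sumr exchange_big /=.
apply: eq_bigr => c _; rewrite !mxE mulr_suml mulr_sumr.
by apply: eq_bigr => e _; rewrite !mxE; ring.
Qed.

Hypotheses (Gsym : (G y)^T = G y) (Gunit : G y \in unitmx).

(** The Koszul formula for fields with constant coefficients, whose brackets vanish. From here on
    Christoffel symbols are handled without indices. *)
Lemma connectionE (X Y Z : 'rV[R]_d) :
  (connection X Y *m G y *m Z^T) ord0 ord0 =
  2^-1 * ((Y *m metric_dir X *m Z^T) ord0 ord0 +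
    (X *m metric_dir Y *m Z^T) ord0 ord0 - (X *m metric_dir Z *m Y^T) ord0 ord0).
Proof.
pose K1 b e c := 2^-1 * (metric_pd b e c + metric_pd e b c - metric_pd c b e).
have inv1 j c : \sum_i invmx (G y) j i * G y i c = (j == c)%:R.
  by have := congr1 (fun M : 'M[R]_d => M j c) (mulVmx Gunit); rewrite !mxE.
have K1E b e c : \sum_i christoffel U G y b e i * G y i c = K1 b e c.
  have EC i : christoffel U G y b e i = \sum_j K1 b e j * invmx (G y) j i.
    rewrite /christoffel mulr_sumr; apply: eq_bigr => j _.
    rewrite -[in RHS]Gsym -trmx_inv mxE /K1 !mxE; ring.
  rewrite (eq_bigr (fun i => \sum_j K1 b e j * (invmx (G y) j i * G y i c))).
    rewrite exchange_big /= (bigD1 c) //= [X in _ + X]big1 ?addr0 => [|j jc].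
      by rewrite -mulr_sumr inv1 eqxx mulr1.
    by rewrite -mulr_sumr inv1 (negbTE jc) mulr0.
  by move=> i _; rewrite EC mulr_suml; apply: eq_bigr => j _; rewrite mulrA.
have -> : (connection X Y *m G y *m Z^T) ord0 ord0 =
    \sum_b \sum_e \sum_c X ord0 b * Y ord0 e * Z ord0 c * K1 b e c.
  rewrite mxE (eq_bigr (fun c => \sum_b \sum_e
     (X ord0 b * Y ord0 e * Z ord0 c * K1 b e c))).
    rewrite exchange_big /=; apply: eq_bigr => b _; exact: exchange_big.
  move=> c _; rewrite !mxE mulr_suml.
  rewrite (eq_bigr (fun i => \sum_b \sum_e X ord0 b * Y ord0 e * Z ord0 c *
    (christoffel U G y b e i * G y i c))); last first.
    move=> i _; rewrite !mxE -mulrA mulr_suml; apply: eq_bigr => b _.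
    by rewrite mulr_suml; apply: eq_bigr => e _; ring.
  rewrite exchange_big /=; apply: eq_bigr => b _.
  rewrite exchange_big /=; apply: eq_bigr => e _.
  by rewrite -mulr_sumr K1E.
have E2 : (X *m metric_dir Y *m Z^T) ord0 ord0 =
    \sum_b \sum_e \sum_c X ord0 b * Y ord0 e * Z ord0 c * metric_pd e b c.
  rewrite metric_dirE exchange_big /=; apply: eq_bigr => b _.
  apply: eq_bigr => e _; apply: eq_bigr => c _; ring.
have E3 : (X *m metric_dir Z *m Y^T) ord0 ord0 =
    \sum_b \sum_e \sum_c X ord0 b * Y ord0 e * Z ord0 c * metric_pd c b e.
  rewrite metric_dirE exchange_big /=; apply: eq_bigr => b _.
  rewrite exchange_big /=; apply: eq_bigr => e _; apply: eq_bigr => c _; ring.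
rewrite metric_dirE E2 E3 -big_split -sumrB mulr_sumr; apply: eq_bigr => b _.
rewrite -big_split -sumrB mulr_sumr; apply: eq_bigr => e _.
rewrite -big_split -sumrB mulr_sumr; apply: eq_bigr => c _ /=.
by rewrite /K1; ring.
Qed.

(** In the sum of the two Koszul formulas the terms differentiated along [Y] and [Z] cancel. *)
Lemma connection_compatible (X Y Z : 'rV[R]_d) :
  (forall b, (metric_pd b)^T = metric_pd b) ->
  (connection X Y *m G y *m Z^T) ord0 ord0 +
  (connection X Z *m G y *m Y^T) ord0 ord0 = (Y *m metric_dir X *m Z^T) ord0 ord0.
Proof.
move=> Hs; have dirs V : (metric_dir V)^T = metric_dir V.
  rewrite /metric_dir linear_sum /=; apply: eq_bigr => b _.
  by rewrite linearZ /= Hs.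
have flip (V A B : 'rV[R]_d) : (A *m metric_dir V *m B^T) ord0 ord0 =
    (B *m metric_dir V *m A^T) ord0 ord0.
  have <- : (B *m metric_dir V *m A^T)^T = A *m metric_dir V *m B^T.
    by rewrite !trmx_mul trmxK dirs mulmxA.
  by rewrite mxE.
by rewrite !connectionE (flip X Z Y); field.
Qed.

End Christoffel.

(** * The weighted Laplacian of the energy of a hypersurface *)

Section FormAlgebra.
Variables (R : realType) (d : nat) (G : 'M[R]_d).
Hypothesis G_sym : G^T = G.
Local Notation B X Y := ((X *m G *m Y^T) ord0 ord0).

Lemma formC (X Y : 'rV[R]_d) : B X Y = B Y X.
Proof.
have <- : (Y *m G *m X^T)^T = X *m G *m Y^T by rewrite !trmx_mul trmxK G_sym mulmxA.
by rewrite mxE.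
Qed.

Lemma formDl (X Y Z : 'rV[R]_d) : B (X + Y) Z = B X Z + B Y Z.
Proof. by rewrite !mulmxDl mxE. Qed.

Lemma leibniz_entry p q (H J : 'M[R]_(p, d)) (K : 'M[R]_(q, d)) (K' : 'M[R]_(q, d))
    (D : 'M[R]_d) b e :
  ((H *m G + J *m D) *m K^T + J *m G *m K'^T) b e =
  B (row b H) (row e K) + (row b J *m D *m (row e K)^T) ord0 ord0 +
  B (row b J) (row e K').
Proof.
rewrite mulmxDl [LHS]mxE [X in X + _ = _]mxE.
by rewrite (mulmx_entry H) (mulmx_entry J D) (mulmx_entry J G K').
Qed.

(** The algebra of the Gauss formula. With [j] the first and [h] the second derivatives of an
    immersion, the left-hand side is the Christoffel symbol of the first kind of the induced metric;
    symmetry of [h] leaves only [h a b], and the derivatives of the metric assemble into the Koszul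
    formula for [n]. *)
Lemma first_kind (I : Type) (h : I -> I -> 'rV[R]_d) (j : I -> 'rV[R]_d)
    (D : 'rV[R]_d -> 'M[R]_d) (n : 'rV[R]_d) a b e :
  (forall a b, h a b = h b a) ->
  B n (j e) = 2^-1 * ((j b *m D (j a) *m (j e)^T) ord0 ord0 +
    (j a *m D (j b) *m (j e)^T) ord0 ord0 - (j a *m D (j e) *m (j b)^T) ord0 ord0) ->
  2^-1 * ((B (h a b) (j e) + (j b *m D (j a) *m (j e)^T) ord0 ord0 +
     B (j b) (h a e)) +
    (B (h b a) (j e) + (j a *m D (j b) *m (j e)^T) ord0 ord0 + B (j a) (h b e)) -
    (B (h e a) (j b) + (j a *m D (j e) *m (j b)^T) ord0 ord0 + B (j a) (h e b))) =
  B (h a b + n) (j e).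
Proof.
move=> hs En; rewrite formDl En (hs b a) (hs e a) (hs e b) (formC (j b)).
by field.
Qed.

End FormAlgebra.

Lemma metric_pd_sym (R : realType) d (P : pred 'I_d) (U : set 'rV[R]_d)
    (G : 'rV[R]_d -> 'M[R]_d) z b :
  relatively_open P U -> (forall i j, Ck 1 U (fun z => G z i j)) ->
  (forall z, U z -> (G z)^T = G z) -> U z ->
  (metric_pd U G z b)^T = metric_pd U G z b.
Proof.
move=> oU G_C1 G_sym Uz; apply/matrixP => i j; rewrite !mxE.
apply: (pd_local oU oU Uz Uz); last exact: (Ck_pd (G_C1 i j) Uz).
move=> z' Uz' _; have := congr1 (fun A : 'M[R]_d => A j i) (G_sym z' Uz').
by rewrite mxE.
Qed.

Section LocalHypersurface.
Variables (R : realType) (m d : nat).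
Variables (P : pred 'I_d) (U : set 'rV[R]_d).
Variables (Q : pred 'I_m) (V W : set 'rV[R]_m).
Hypotheses (oU : relatively_open P U) (oV : relatively_open Q V).
Hypotheses (oW : relatively_open Q W) (WV : W `<=` V).
Variables (G : 'rV[R]_d -> 'M[R]_d) (psi : 'rV[R]_d -> R).
Variables (f N : 'rV[R]_m -> 'rV[R]_d).
Variables (g : 'rV[R]_m -> 'M[R]_m) (w u : 'rV[R]_m -> R).
Hypothesis fU : forall y, W y -> U (f y).
Hypothesis f_C2 : forall b, Ck 2 W (fun y => f y ord0 b).
Hypothesis N_C1 : forall b, Ck 1 W (fun y => N y ord0 b).
Hypothesis G_C1 : forall i j, Ck 1 U (fun z => G z i j).
Hypothesis psi_C1 : Ck 1 U psi.
Hypothesis G_sym : forall z, U z -> (G z)^T = G z.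
Local Notation J := (jac W f).
Hypothesis g_induced : forall y, W y -> g y = J y *m G (f y) *m (J y)^T.
Hypothesis N_normal : forall y, W y -> J y *m G (f y) *m (N y)^T = 0.
Hypothesis w_restr : forall y, W y -> w y = psi (f y).

(** [V] models the image of a chart of the hypersurface and [W] its part sent into one chart of [M].
    Metric and functions of the hypersurface are differentiated on [V], the immersion and the normal
    on [W]. *)
Lemma pd_restrict a (h h' : 'rV[R]_m -> R) x l : W x ->
  (forall y, W y -> h' y = h y) -> is_pd W a h' x l -> pd V a h x = l.
Proof.
move=> Wx hh H; apply: (is_pd_eq oV (WV Wx)).
by apply: (is_pd_local oW oV Wx (WV Wx) _ H) => y Wy _; exact: hh.
Qed.

Lemma is_mpd_map a x : W x -> is_mpd W a f x (row a (J x)).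
Proof.
move=> Wx i j; rewrite (ord1 i) !mxE.
exact: (Ck_pd (CkS (f_C2 j)) Wx).
Qed.

Definition hess a x : 'M[R]_(m, d) :=
  \matrix_(i, j) pd W a (fun y => J y i j) x.

Lemma jac_entry i j : (fun y => J y i j) = pd W i (fun y => f y ord0 j).
Proof. by apply/funext => y; rewrite mxE. Qed.

Lemma hess_entry a x i j :
  hess a x i j = pd W a (pd W i (fun y => f y ord0 j)) x.
Proof. by rewrite mxE jac_entry. Qed.

Lemma is_mpd_jac a x : W x -> is_mpd W a J x (hess a x).
Proof.
move=> Wx i j; rewrite hess_entry jac_entry.
exact: (Ck_pd (Ck_dS i (f_C2 j)) Wx).
Qed.

Lemma hess_sym a b x : W x -> row b (hess a x) = row a (hess b x).
Proof.
move=> Wx; apply/rowP => j; rewrite [LHS]mxE [RHS]mxE.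
apply: (etrans (hess_entry a x b j) (etrans _ (esym (hess_entry b x a j)))).
exact: (pd_comm oW a b (f_C2 j) Wx).
Qed.

Lemma is_mpd_metric a x : W x ->
  is_mpd W a (fun y => G (f y)) x (metric_dir U G (f x) (row a (J x))).
Proof.
move=> Wx i j; rewrite summxE.
rewrite (_ : \sum_b _ = \sum_b row a (J x) ord0 b * pd U b (fun z => G z i j) (f x)).
  by apply: (is_pd_comp oU (G_C1 i j) fU Wx) => b; exact: is_mpd_map.
by apply: eq_bigr => b _; rewrite !mxE.
Qed.

Definition normal_jac a x : 'rV[R]_d := \row_b pd W a (fun y => N y ord0 b) x.

Lemma is_mpd_normal a x : W x -> is_mpd W a N x (normal_jac a x).
Proof.
by move=> Wx i j; rewrite (ord1 i) mxE; exact: (Ck_pd (N_C1 j) Wx).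
Qed.

Section AtPoint.
Variable x : 'rV[R]_m.
Hypothesis Wx : W x.
Local Notation y := (f x).
Local Notation Jx := (J x).
Local Notation B X Y := ((X *m G y *m Y^T) ord0 ord0).
Local Notation nabla := (connection U G y).
Local Notation dG := (metric_dir U G y).
Hypothesis Gunit : G y \in unitmx.

(** The ambient covariant derivative of the coordinate field [b] along the coordinate field [a]. It
    still has a tangential part, which carries the induced connection; its normal part is the second
    fundamental form. *)
Definition second_form a b : 'rV[R]_d :=
  row b (hess a x) + nabla (row a Jx) (row b Jx).

Lemma pd_induced a b e : pd V a (fun z => g z b e) x =
  B (row b (hess a x)) (row e Jx) +
  (row b Jx *m dG (row a Jx) *m (row e Jx)^T) ord0 ord0 +
  B (row b Jx) (row e (hess a x)).
Proof.
have H := is_mpdM (is_mpdM (is_mpd_jac (a := a) Wx) (is_mpd_metric (a := a) Wx))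
  (is_mpd_tr (is_mpd_jac (a := a) Wx)).
apply: etrans (pd_restrict Wx _ (H b e)) _; first by move=> z Wz; rewrite g_induced.
exact: leibniz_entry.
Qed.

(** Gauss formula: [G J^T g^-1] reads off the tangential coordinates of [second_form]. *)
Lemma christoffel_induced a b c : christoffel V g x a b c =
  (second_form a b *m G y *m Jx^T *m invmx (g x)) ord0 c.
Proof.
have gs : (g x)^T = g x.
  by rewrite g_induced // !trmx_mul trmxK (G_sym (fU Wx)) mulmxA.
have K e : 2^-1 * (pd V a (fun z => g z b e) x + pd V b (fun z => g z a e) x -
    pd V e (fun z => g z a b) x) = B (second_form a b) (row e Jx).
  rewrite (pd_induced a b e) (pd_induced b a e) (pd_induced e a b).
  apply: (@first_kind _ _ _ (G_sym (fU Wx)) _ (fun a b => row b (hess a x))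
    (fun a => row a Jx)).
    by move=> a' b'; exact: hess_sym.
  by apply: connectionE => //; exact: G_sym (fU Wx).
rewrite /christoffel mulr_sumr [RHS]mxE; apply: eq_bigr => e _.
rewrite mulrCA K mulrC; congr (_ * _).
  by rewrite [RHS]mulmx_entry row_id.
by rewrite -[in LHS]gs -trmx_inv mxE.
Qed.

Hypothesis md : m.+1 = d.
Hypothesis gunit : g x \in unitmx.
Hypothesis N_unit : N x *m G y *m (N x)^T = 1%:M.
Local Notation Nx := (N x).

Lemma gauss_frame : Jx^T *m invmx (g x) *m Jx + Nx^T *m Nx = invmx (G y).
Proof.
rewrite g_induced //; apply: frame_inverse => //; first exact: G_sym (fU Wx).
  by rewrite -[J x *m G (f x) *m _]g_induced.
exact: N_normal.
Qed.

Local Notation D := (covariant_along U G W f N x).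

Lemma row_covariant a : row a D = normal_jac a x + nabla (row a Jx) Nx.
Proof.
apply/rowP => c; rewrite !mxE; congr (_ + _).
by apply: eq_bigr => b _; apply: eq_bigr => e _; rewrite !mxE.
Qed.

(** Differentiate the orthogonality relation [J G N^T = 0] and absorb the derivative of the metric
    by compatibility of the connection. *)
Lemma weingarten a b : B (second_form a b) Nx = - (D *m G y *m Jx^T) a b.
Proof.
have H := is_mpdM (is_mpdM (is_mpd_jac (a := a) Wx) (is_mpd_metric (a := a) Wx))
  (is_mpd_tr (is_mpd_normal (a := a) Wx)).
have E : ((hess a x *m G y + Jx *m dG (row a Jx)) *m Nx^T +
    Jx *m G y *m (normal_jac a x)^T) b ord0 = 0.
  apply: (etrans (esym (is_pd_eq oW Wx (H b ord0)))); apply: (is_pd_eq oW Wx).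
  apply: (is_pd_local oW oW Wx Wx _ (is_pd_cst W a 0 x)) => z Wz _.
  by rewrite N_normal // mxE.
rewrite leibniz_entry !row_id in E.
have C := connection_compatible (G_sym (fU Wx)) Gunit (row a Jx) (row b Jx) Nx
  (fun c => metric_pd_sym c oU G_C1 G_sym (fU Wx)).
rewrite [X in _ = - X]mulmx_entry row_covariant /second_form !formDl.
rewrite -C (formC (G_sym (fU Wx)) (row b Jx)) in E.
by apply/eqP; rewrite -addr_eq0 -[X in _ == X]E; apply/eqP; ring.
Qed.

Variable Pi : 'M[R]_d.
Hypothesis Pi_sym : Pi^T = Pi.
Hypothesis G_Pi : G y *m Pi = Pi.
Hypothesis nabla_Pi : forall X Y, nabla X Y *m Pi = 0.
Hypothesis u_restr :
  forall z, W z -> u z = 2^-1 * (f z *m Pi *m (f z)^T) ord0 ord0.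
Local Notation s := ((Nx *m Pi *m y^T) ord0 ord0).

(** [Pi] abstracts the projection onto the Euclidean factor. By [nabla_Pi] the Christoffel terms
    vanish on the differential of its quadratic form, so [Pi] is the ambient covariant Hessian of
    half that form. *)
Lemma pd_energy c z : W z -> pd V c u z = (J z *m Pi *m (f z)^T) c ord0.
Proof.
move=> Wz.
have H := is_mpdM (is_mpdM (is_mpd_map (a := c) Wz) (is_mpd_cst W c Pi z))
  (is_mpd_tr (is_mpd_map (a := c) Wz)).
rewrite (pd_restrict Wz _ (is_pdZ (c := 2^-1) (H ord0 ord0))); last first.
  by move=> z' Wz'; rewrite u_restr.
rewrite mulmx0 addr0 mxE [RHS]mulmx_entry row_id (formC Pi_sym (f z)).
by field.
Qed.

Lemma pd2_energy a b : pd V a (pd V b u) x =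
  (row b (hess a x) *m Pi *m y^T) ord0 ord0 + (Jx *m Pi *m Jx^T) b a.
Proof.
have H := is_mpdM (is_mpdM (is_mpd_jac (a := a) Wx) (is_mpd_cst W a Pi x))
  (is_mpd_tr (is_mpd_map (a := a) Wx)).
rewrite (pd_restrict Wx _ (H b ord0)); last first.
  by move=> z Wz; rewrite pd_energy.
rewrite mulmx0 addr0 mxE (mulmx_entry (hess a x)) (mulmx_entry Jx Pi (row a Jx)).
by rewrite !row_id -mulmx_entry.
Qed.

(** Restricting a function adds to its Hessian the second fundamental form times its normal
    derivative, here [s]; [gauss_frame] removes the tangential part of [second_form]. *)
Lemma hessian_energy a b :
  pd V a (pd V b u) x - \sum_c christoffel V g x a b c * pd V c u x =
  (Jx *m Pi *m Jx^T) b a - (D *m G y *m Jx^T) a b * s.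
Proof.
have -> : \sum_c christoffel V g x a b c * pd V c u x =
    (second_form a b *m G y *m Jx^T *m invmx (g x) *m (Jx *m Pi *m y^T)) ord0 ord0.
  rewrite [RHS]mxE; apply: eq_bigr => c _.
  by rewrite christoffel_induced pd_energy.
have -> : second_form a b *m G y *m Jx^T *m invmx (g x) *m (Jx *m Pi *m y^T) =
    second_form a b *m G y *m (Jx^T *m invmx (g x) *m Jx) *m (Pi *m y^T).
  by rewrite !mulmxA.
have -> : Jx^T *m invmx (g x) *m Jx = invmx (G y) - Nx^T *m Nx.
  by rewrite -gauss_frame addrK.
have -> : second_form a b *m G y *m (invmx (G y) - Nx^T *m Nx) *m (Pi *m y^T) =
    row b (hess a x) *m Pi *m y^T -
    (second_form a b *m G y *m Nx^T) *m (Nx *m Pi *m y^T).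
  rewrite mulmxBr mulmxBl mulmxK // {1}/second_form mulmxDl.
  by rewrite [nabla _ _ *m _]mulmxA nabla_Pi mul0mx addr0 !mulmxA.
rewrite [X in _ - X]mxE [X in _ - (_ + X)]mxE [X in _ - (_ - X)]mxE.
rewrite big_ord1 weingarten pd2_energy.
by rewrite mulNr; ring.
Qed.

Lemma invmx_induced_sym : (invmx (g x))^T = invmx (g x).
Proof.
rewrite trmx_inv g_induced // !trmx_mul trmxK (G_sym (fU Wx)).
by rewrite mulmxA.
Qed.

Lemma laplacian_energy : laplacian V g u x =
  \tr (Pi *m invmx (G y)) - (Nx *m Pi *m Nx^T) ord0 ord0
  - tangential_div G y Jx D * s.
Proof.
have -> : \tr (Pi *m invmx (G y)) - (Nx *m Pi *m Nx^T) ord0 ord0 =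
    \tr (invmx (g x) *m (Jx *m Pi *m Jx^T)).
  have -> : (Nx *m Pi *m Nx^T) ord0 ord0 = \tr (Pi *m (Nx^T *m Nx)).
    by rewrite mulmxA mxtrace_mulC mulmxA /mxtrace big_ord1.
  rewrite -raddfB -mulmxBr -gauss_frame addrK [RHS]mxtrace_mulC -!mulmxA.
  by rewrite [RHS]mxtrace_mulC -!mulmxA.
have inv_sym a b : invmx (g x) a b = invmx (g x) b a.
  by rewrite -{1}invmx_induced_sym mxE.
rewrite /laplacian /tangential_div -g_induced // /mxtrace mulr_suml.
rewrite [X in _ - X](eq_bigr (fun b => \sum_a
    invmx (g x) a b * ((D *m G y *m Jx^T) a b * s))); last first.
  move=> b _; rewrite mxE mulr_suml; apply: eq_bigr => a _.
  by rewrite [X in X * _ * _]inv_sym mulrA.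
rewrite [X in _ - X]exchange_big -sumrB; apply: eq_bigr => a _.
rewrite mxE -sumrB; apply: eq_bigr => b _.
by rewrite hessian_energy mulrBr.
Qed.

Local Notation dpsi := (\row_b pd U b psi y).

Lemma row_pd_weight : \row_a pd V a w x = dpsi *m Jx^T.
Proof.
apply/rowP => a; rewrite !mxE.
have H := is_pd_comp oU psi_C1 fU Wx
  (fun b => @is_mpd_map a x Wx ord0 b).
rewrite (pd_restrict Wx _ H); last by move=> z Wz; rewrite w_restr.
by apply: eq_bigr => b _; rewrite !mxE mulrC.
Qed.

Lemma row_pd_energy : \row_a pd V a u x = (Jx *m Pi *m y^T)^T.
Proof. by apply/rowP => a; rewrite !mxE pd_energy // mxE. Qed.

(** The normal component of the gradient of [psi] enters with the same factor [s] as the divergence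
    of [N], and together they form the weighted mean curvature. *)
Theorem weighted_laplacian_energy : weighted_laplacian V g w u x =
  \tr (Pi *m invmx (G y)) - (Nx *m Pi *m Nx^T) ord0 ord0
  + (dpsi *m Pi *m y^T) ord0 ord0
  + weighted_mean_curvature U G psi y Jx D Nx * s.
Proof.
rewrite /weighted_laplacian laplacian_energy /weighted_mean_curvature.
have -> : inner g x (grad V g w x) (grad V g u x) =
    (dpsi *m Pi *m y^T) ord0 ord0 - (dpsi *m Nx^T) ord0 ord0 * s.
  rewrite /inner /grad row_pd_weight row_pd_energy.
  rewrite trmx_mul trmxK invmx_induced_sym.
  rewrite -[dpsi *m Jx^T *m _ *m _]mulmxA mulVmx // mulmx1.
  have -> : dpsi *m Jx^T *m (invmx (g x) *m (Jx *m Pi *m y^T)) =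
      dpsi *m (Jx^T *m invmx (g x) *m Jx) *m Pi *m y^T by rewrite !mulmxA.
  have -> : Jx^T *m invmx (g x) *m Jx = invmx (G y) - Nx^T *m Nx.
    by rewrite -gauss_frame addrK.
  have Ginv_Pi : invmx (G y) *m Pi = Pi by rewrite -{1}G_Pi mulKmx.
  rewrite mulmxBr mulmxBl mulmxBl -[dpsi *m invmx _ *m _]mulmxA Ginv_Pi.
  have -> : dpsi *m (Nx^T *m Nx) *m Pi *m y^T =
      (dpsi *m Nx^T) *m (Nx *m Pi *m y^T) by rewrite !mulmxA.
  by rewrite [LHS]mxE [X in _ + X = _]mxE [X in _ - X = _]mxE big_ord1.
have -> : inner G y (grad U G psi y) Nx = (dpsi *m Nx^T) ord0 ord0.
  by rewrite /inner /grad mulmxKV.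
by ring.
Qed.

End AtPoint.
End LocalHypersurface.

(** * The Riemannian product with a Euclidean space *)

Lemma relatively_openI (R : realType) d (P : pred 'I_d) (O : set 'rV[R]_d) :
  open O -> relatively_open P (O `&` orthant P).
Proof.
move=> oO; split => [x []//|x [Ox _]].
have [e e0 eO] := near_point_open oO Ox.
by exists e => // y xy Py; split => //; exact: eO.
Qed.

Definition first_coord d : pred 'I_d := fun a => val a == 0%N.

Lemma halfspaceE (R : realType) d : @halfspace R d = orthant (@first_coord d).
Proof.
by apply/seteqP; split => x H a /eqP a0; apply: H => //; exact/eqP.
Qed.

Lemma chart_im_relatively_open (R : realType) d (M : manifold R d)
    (i : chart_index M) : relatively_open (@first_coord d) (chart_im i).
Proof.
have [D oD imE] := chart_im_open i.
by rewrite /chart_im imE halfspaceE; exact: relatively_openI.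
Qed.

Section LaplacianCst.
Variables (R : realType) (d : nat) (P : pred 'I_d) (V : set 'rV[R]_d).
Hypothesis oV : relatively_open P V.

Lemma weighted_laplacian_cst g w (c : R) x :
  V x -> weighted_laplacian V g w (fun=> c) x = 0.
Proof.
move=> Vx.
have pd0 a y : V y -> pd V a (fun=> c) y = 0.
  by move=> Vy; apply: (is_pd_eq oV Vy); exact: is_pd_cst.
have pd00 a b : pd V a (pd V b (fun=> c)) x = 0.
  apply: (is_pd_eq oV Vx).
  apply: (is_pd_local oV oV Vx Vx _ (is_pd_cst V a 0 x)) => y Vy _.
  by rewrite pd0.
rewrite /weighted_laplacian /laplacian big1 ?add0r => [|a _].
  rewrite /inner /grad (_ : \row_a pd V a (fun=> c) x = 0).
    by rewrite mul0mx trmx0 mulmx0 mxE.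
  by apply/rowP => a; rewrite !mxE pd0.
rewrite big1 // => b _; rewrite pd00 big1 ?subrr ?mulr0 // => e _.
by rewrite pd0 // mulr0.
Qed.

End LaplacianCst.

Section Product.
Variables (R : realType) (n k : nat) (M : riemannian R n) (i : chart_index M).
Local Notation U := (prod_im (k := k) i).
Local Notation G := (prod_metric (k := k) i).

(** When [n = 0] the coordinate of index 0 is Euclidean and must stay unconstrained, whence the
    second condition. *)
Definition prod_first_coord : pred 'I_(n + k) :=
  fun c => (val c == 0%N) && (val c < n)%N.

Lemma prod_im_relatively_open : relatively_open prod_first_coord U.
Proof.
have [UP oU] := chart_im_relatively_open i; split.
  move=> y /UP Uy c /andP[c0 cn].
  have := Uy (Ordinal cn) c0; rewrite mxE.
  by rewrite (_ : lshift k (Ordinal cn) = c) //; exact: val_inj.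
move=> y /oU[e e0 eU]; exists e => // z yz Pz; apply: eU.
  by move=> b; rewrite !mxE; exact: yz.
move=> b b0; rewrite mxE; apply: Pz.
by apply/andP; split; [exact: b0|exact: (ltn_ord b)].
Qed.

Lemma is_pd_lsub (h : 'rV[R]_n -> R) b y l : is_pd (chart_im i) b h (lsubmx y) l ->
  is_pd U (lshift k b) (fun z => h (lsubmx z)) y l.
Proof.
have E s : lsubmx (y + s *: delta_mx ord0 (lshift k b)) =
    lsubmx y + s *: delta_mx ord0 b.
  apply/rowP => c; rewrite !mxE eqxx /=.
  by rewrite (inj_eq (@lshift_inj _ _)).
move=> /is_pdP H; apply/is_pdP => e e0; have [r r0 rH] := H e e0.
by exists r => // s s0 sr; rewrite /prod_im /= E; exact: rH.
Qed.

Lemma is_pd_rsub (h : 'rV[R]_n -> R) b y :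
  is_pd U (rshift n b) (fun z => h (lsubmx z)) y 0.
Proof.
have E s : lsubmx (y + s *: delta_mx ord0 (rshift n b)) = lsubmx y.
  by apply/rowP => c; rewrite !mxE eq_lrshift andbF mulr0 addr0.
apply/is_pdP => e e0; exists 1 => // s _ _ _.
by rewrite E subrr mulr0 subr0 normr0.
Qed.

Lemma Ck_lsub r (h : 'rV[R]_n -> R) : Ck r (chart_im i) h ->
  Ck r U (fun z => h (lsubmx z)).
Proof.
have C0 (f : 'rV[R]_n -> R) : continuous_on (chart_im i) f ->
    continuous_on U (fun z => f (lsubmx z)).
  move=> /continuous_withinP H; apply/continuous_withinP => y Uy e e0.
  have [s s0 sH] := H _ Uy e e0; exists s => // z Uz yz; apply: sH => // b.
  by rewrite !mxE; exact: yz.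
elim: r h => [|r IH] h Ch; first by split => //; exact: C0 (Ck0 Ch).
refine (@Ck_by_pd _ _ _ _ prod_im_relatively_open r (fun z => h (lsubmx z)) (fun c z =>
  if fintype.split c is inl b then pd (chart_im i) b h (lsubmx z) else 0) _ _ _).
- exact: C0 (Ck0 Ch).
- move=> c z Uz; cbv beta; case: (split_ordP c) => b ->.
    exact: is_pd_lsub (Ck_pd Ch Uz).
  exact: is_pd_rsub.
- move=> c; case: (fintype.split c) => b; first exact: IH (Ck_dS b Ch).
  exact: (Ck_cst prod_im_relatively_open).
Qed.

Lemma prod_metric_C1 c e : Ck 1 U (fun z => G z c e).
Proof.
have oU := prod_im_relatively_open.
case: (split_ordP c) => a ->; case: (split_ordP e) => b ->.
- rewrite (_ : (fun z => _) = fun z => metric i (lsubmx z) a b).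
    exact: (Ck_lsub (metric_smooth i a b 1)).
  by apply/funext => z; rewrite block_mxEul.
- rewrite (_ : (fun z => _) = fun=> 0); first exact: (Ck_cst oU).
  by apply/funext => z; rewrite block_mxEur mxE.
- rewrite (_ : (fun z => _) = fun=> 0); first exact: (Ck_cst oU).
  by apply/funext => z; rewrite block_mxEdl mxE.
- rewrite (_ : (fun z => _) = fun=> (1%:M : 'M[R]_k) a b).
    exact: (Ck_cst oU).
  by apply/funext => z; rewrite block_mxEdr.
Qed.

Lemma prod_metric_sym z : U z -> (G z)^T = G z.
Proof.
move=> Uz; rewrite /prod_metric tr_block_mx Defs.metric_sym // !trmx0 trmx1.
by [].
Qed.

(** Both the projection onto the Euclidean factor and the form [|v_2|^2]; the two agree because the
    Euclidean block of the metric is the identity. *)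
Definition eproj : 'M[R]_(n + k) := block_mx 0 0 0 1%:M.

Lemma prod_metric_form z (v : 'rV[R]_(n + k)) :
  (v *m G z *m v^T) ord0 ord0 =
  (lsubmx v *m metric i (lsubmx z) *m (lsubmx v)^T) ord0 ord0 +
  (v *m eproj *m v^T) ord0 ord0.
Proof.
rewrite -[v]hsubmxK row_mxKl; set v1 := lsubmx v; set v2 := rsubmx v.
rewrite tr_row_mx /prod_metric /eproj !mul_row_block !mulmx0 !addr0 !add0r.
by rewrite !mulmx1 !mul_row_col mul0mx add0r mxE.
Qed.

Lemma eproj_form (v w : 'rV[R]_(n + k)) : (v *m eproj *m w^T) ord0 ord0 =
  \sum_b v ord0 (rshift n b) * w ord0 (rshift n b).
Proof.
rewrite -[v in LHS]hsubmxK -[w in LHS]hsubmxK tr_row_mx mul_row_block.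
rewrite !mulmx0 addr0 add0r mulmx1 mul_row_col mul0mx add0r mxE.
by apply: eq_bigr => b _; rewrite !mxE.
Qed.

Lemma eproj_form_ge0 (v : 'rV[R]_(n + k)) : 0 <= (v *m eproj *m v^T) ord0 ord0.
Proof.
by rewrite eproj_form; apply: sumr_ge0 => b _; rewrite -expr2 sqr_ge0.
Qed.

Lemma metric_form_ge0 z (v : 'rV[R]_n) : chart_im i z ->
  0 <= (v *m metric i z *m v^T) ord0 ord0.
Proof.
move=> Uz; have [->|v0] := eqVneq v 0; first by rewrite !mul0mx mxE.
exact/ltW/metric_pos.
Qed.

Lemma prod_metric_pos z (v : 'rV[R]_(n + k)) : U z -> v != 0 ->
  0 < (v *m G z *m v^T) ord0 ord0.
Proof.
move=> Uz v0; rewrite prod_metric_form.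
have [l0|l0] := eqVneq (lsubmx v) 0; last first.
  by rewrite ltr_wpDr ?eproj_form_ge0 //; exact: metric_pos.
rewrite l0 !mul0mx mxE add0r lt_def eproj_form_ge0 andbT.
apply: contra v0; rewrite eproj_form psumr_eq0 => [/allP H|b _]; last first.
  by rewrite -expr2 sqr_ge0.
rewrite -[v]hsubmxK l0 (_ : rsubmx v = 0) ?row_mx0 //.
apply/rowP => b; have := H b (mem_index_enum b).
by rewrite !mxE /= mulf_eq0 orbb => /eqP.
Qed.

Lemma prod_metric_unit z : U z -> G z \in unitmx.
Proof. by move=> Uz; apply: posdef_unitmx => v; exact: prod_metric_pos. Qed.

Lemma eproj_sym : eproj^T = eproj.
Proof. by rewrite tr_block_mx !trmx0 trmx1. Qed.

Lemma prod_metric_eproj z : G z *m eproj = eproj.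
Proof.
rewrite /prod_metric /eproj mulmx_block !mulmx0 !mul0mx mulmx1.
by rewrite !addr0 !add0r.
Qed.

Lemma eproj_prod_metric z : eproj *m G z = eproj.
Proof.
rewrite /prod_metric /eproj mulmx_block !mulmx0 !mul0mx mulmx1.
by rewrite !addr0 !add0r.
Qed.

Lemma eproj_idem : eproj *m eproj = eproj.
Proof. by rewrite /eproj mulmx_block !mulmx0 !mul0mx mulmx1 !addr0 add0r. Qed.

Lemma tr_eproj : \tr eproj = k%:R.
Proof. by rewrite mxtrace_block mxtrace0 mxtrace1 add0r. Qed.

Lemma metric_pd_rshift z b : U z -> metric_pd U G z (rshift n b) = 0.
Proof.
have oU := prod_im_relatively_open; move=> Uz.
apply/matrixP => c e; rewrite mxE mxE; apply: (is_pd_eq oU Uz).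
case: (split_ordP c) => a ->; case: (split_ordP e) => d ->.
- rewrite (_ : (fun z => _) = fun z => metric i (lsubmx z) a d).
    exact: (is_pd_rsub (fun z => metric i z a d)).
  by apply/funext => z'; rewrite block_mxEul.
- rewrite (_ : (fun z => _) = fun=> 0); first exact: is_pd_cst.
  by apply/funext => z'; rewrite block_mxEur mxE.
- rewrite (_ : (fun z => _) = fun=> 0); first exact: is_pd_cst.
  by apply/funext => z'; rewrite block_mxEdl mxE.
- rewrite (_ : (fun z => _) = fun=> (1%:M : 'M[R]_k) a d); first exact: is_pd_cst.
  by apply/funext => z'; rewrite block_mxEdr.
Qed.

Lemma metric_pd_eproj z b : U z -> metric_pd U G z b *m eproj = 0.
Proof.
have oU := prod_im_relatively_open; move=> Uz.
rewrite -[metric_pd _ _ _ _]hsubmxK mul_row_block !mulmx0 addr0 add0r mulmx1.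
rewrite (_ : rsubmx _ = 0) ?row_mx0 //.
apply/matrixP => c e; rewrite !mxE; apply: (is_pd_eq oU Uz).
case: (split_ordP c) => a ->.
- rewrite (_ : (fun z => _) = fun=> 0); first exact: is_pd_cst.
  by apply/funext => z'; rewrite block_mxEur mxE.
- rewrite (_ : (fun z => _) = fun=> (1%:M : 'M[R]_k) a e); first exact: is_pd_cst.
  by apply/funext => z'; rewrite block_mxEdr.
Qed.

Lemma prod_metric_pd_sym z b : U z -> (metric_pd U G z b)^T = metric_pd U G z b.
Proof.
exact: (metric_pd_sym b prod_im_relatively_open prod_metric_C1 prod_metric_sym).
Qed.

Lemma metric_dir_eproj z X : U z -> metric_dir U G z X *m eproj = 0.
Proof.
move=> Uz; rewrite /metric_dir mulmx_suml big1 // => b _.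
by rewrite -scalemxAl metric_pd_eproj // scaler0.
Qed.

Lemma eproj_metric_dir z X : U z -> eproj *m metric_dir U G z X = 0.
Proof.
move=> Uz; rewrite /metric_dir mulmx_sumr big1 // => b _.
rewrite -scalemxAr -[metric_pd _ _ _ _]trmxK -eproj_sym -trmx_mul.
by rewrite prod_metric_pd_sym // metric_pd_eproj // trmx0 scaler0.
Qed.

Lemma metric_dir_along_eproj z X : U z -> metric_dir U G z (X *m eproj) = 0.
Proof.
move=> Uz; rewrite /metric_dir big1 // => c _.
case: (split_ordP c) => b ->; last by rewrite metric_pd_rshift // scaler0.
rewrite -[X]hsubmxK mul_row_block !mulmx0 addr0 row_mxEl mxE.
by rewrite scale0r.
Qed.

Lemma row_form_eq0 d (v : 'rV[R]_d) :
  (forall Z : 'rV[R]_d, (v *m Z^T) ord0 ord0 = 0) -> v = 0.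
Proof.
move=> H; apply/rowP => b; have := H (delta_mx ord0 b).
by rewrite trmx_delta -colE [LHS]mxE => ->; rewrite mxE.
Qed.
End Product.

(** * The curvature of the cylinders *)

Lemma is_pd_coord (R : realType) d (U : set 'rV[R]_d) a b x :
  is_pd U a (fun v => v ord0 b) x (b == a)%:R.
Proof.
apply/is_pdP => e e0; exists 1 => // h h0 _ _.
by rewrite stepE [_ + _ *+ _]addrC addrK -[h *+ _]mulr_natr mulKf // subrr normr0.
Qed.

Lemma mxtrace_rotate (R : comRingType) m d (A : 'M[R]_m) (E : 'M[R]_(m, d))
    (P : 'M[R]_d) : \tr (A *m (E *m P *m E^T)) = \tr (P *m (E^T *m A *m E)).
Proof. by rewrite [LHS]mxtrace_mulC -!mulmxA [LHS]mxtrace_mulC -!mulmxA. Qed.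

Section Cylinder.
Variables (R : realType) (n k : nat) (M : riemannian R n) (i : chart_index M).
Local Notation U := (prod_im (k := k) i).
Local Notation G := (prod_metric (k := k) i).
Local Notation Pi := (eproj R n k).

(** In the Koszul formula tested against a Euclidean vector, every term differentiates the metric
    along that vector or pairs a derivative of the metric with it; both vanish in the product. *)
Lemma connection_eproj z X Y : U z -> connection U G z X Y *m Pi = 0.
Proof.
move=> Uz; apply: row_form_eq0 => Z.
have := connectionE U (prod_metric_sym Uz) (prod_metric_unit Uz) X Y (Z *m Pi).
rewrite metric_dir_along_eproj // mulmx0 mul0mx trmx_mul eproj_sym.
rewrite !mulmxA -[Y *m _ *m Pi]mulmxA -[X *m _ *m Pi]mulmxA.
have z0 : (0 : 'M[R]_1) ord0 ord0 = 0 by rewrite mxE.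
rewrite !metric_dir_eproj // !mulmx0 !mul0mx z0 addr0 subr0 mulr0.
by rewrite -[connection U G z X Y *m _ *m Pi]mulmxA prod_metric_eproj.
Qed.

Lemma connection_along_eproj z X Y : U z -> connection U G z X (Y *m Pi) = 0.
Proof.
move=> Uz; have Gu := prod_metric_unit Uz.
rewrite -[LHS](mulmxK Gu) (_ : _ *m G z = 0) ?mul0mx //.
apply: row_form_eq0 => Z.
rewrite (connectionE U (prod_metric_sym Uz) Gu) metric_dir_along_eproj //.
rewrite trmx_mul eproj_sym mulmxA -[X *m _ *m Pi]mulmxA metric_dir_eproj //.
rewrite -[Y *m Pi *m _]mulmxA eproj_metric_dir // !mulmx0 !mul0mx.
have z0 : (0 : 'M[R]_1) ord0 ord0 = 0 by rewrite mxE.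
by rewrite z0 addr0 subr0 mulr0.
Qed.

Lemma trace_eproj_invmx z : U z -> \tr (Pi *m invmx (G z)) = k%:R.
Proof.
move=> Uz; rewrite -(eproj_prod_metric i z) mulmxK ?prod_metric_unit //.
by rewrite tr_eproj.
Qed.

Lemma mulmx_tr_eproj (y : 'rV[R]_(n + k)) :
  Pi *m y^T = col_mx 0 (rsubmx y)^T.
Proof.
rewrite -{1}[y]hsubmxK tr_row_mx mul_block_col !mul0mx mul1mx addr0 add0r.
by [].
Qed.

Lemma enormE d (t : 'rV[R]_d) : enorm t ^+ 2 = \sum_a t ord0 a ^+ 2.
Proof. by rewrite sqr_sqrtr // sumr_ge0 // => a _; exact: sqr_ge0. Qed.

Lemma enorm_eproj (y : 'rV[R]_(n + k)) :
  (y *m Pi *m y^T) ord0 ord0 = enorm (rsubmx y) ^+ 2.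
Proof.
by rewrite eproj_form enormE; apply: eq_bigr => b _; rewrite mxE expr2.
Qed.

Lemma cylinder_tangent_rank (t : 'rV[R]_k) : t != 0 ->
  (\rank (cylinder_tangent n t)).+1 = (n + k)%N.
Proof.
move=> t0; rewrite mxrank_ker.
set A := col_mx _ _.
have A0 : A != 0.
  apply: contra t0 => /eqP /(congr1 dsubmx).
  by rewrite col_mxKd linear0 => /(congr1 trmx); rewrite trmxK trmx0 => ->.
have rA : \rank A = 1%N.
  by apply/eqP; rewrite eqn_leq rank_leq_col lt0n mxrank_eq0.
rewrite rA subn1 prednK //; apply: leq_trans (rank_leq_row A).
by rewrite rA.
Qed.

Lemma cylinder_curvatureE psi r z : 0 < r -> chart_dom i z.1 -> enorm z.2 = r ->
  cylinder_curvature psi r i z = r^-1 * (k%:R - 1 +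
    ((\row_b pd U b (prod_in_chart i psi) (prod_chart i z)) *m Pi
      *m (prod_chart i z)^T) ord0 ord0).
Proof.
move=> r0 iz zr; rewrite /cylinder_curvature.
set y := prod_chart i z; set X := fun y => row_mx _ _.
set D := covariant_along _ _ _ _ _ _.
have Uy : U y by rewrite /prod_im /= row_mxKl; exists z.1.
have oU := @prod_im_relatively_open R n k M i.
have Gu := prod_metric_unit Uy; have Gs := prod_metric_sym Uy.
have ry : rsubmx y = z.2 by rewrite row_mxKr.
have XE v : X v = - r^-1 *: (v *m Pi).
  rewrite /X -[v in RHS]hsubmxK mul_row_block !mulmx0 !addr0 add0r mulmx1.
  by rewrite scale_row_mx scaler0 scaleNr.
(* [X] is linear in the coordinates, and the connection does not act on Euclidean fields. *)
have DE : D = - r^-1 *: Pi.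
  apply/row_matrixP => a.
  have -> : row a D = row a (- r^-1 *: Pi) +
      connection U G y (delta_mx ord0 a) (X y).
    apply/rowP => c; rewrite mxE [LHS]mxE [RHS]mxE; congr (_ + _).
      rewrite [RHS]mxE; apply: (is_pd_eq oU Uy).
      rewrite (_ : (fun v => X v ord0 c) =
          fun v : 'rV[R]_(n + k) => \sum_b (- r^-1 * Pi b c) * v ord0 b).
        have -> : (- r^-1 *: Pi) a c = \sum_b (- r^-1 * Pi b c) * (a == b)%:R.
          rewrite (bigD1 a) //= eqxx mulr1 big1 ?addr0 ?mxE // => b ba.
          by rewrite eq_sym (negbTE ba) mulr0.
        apply: is_pd_sum => b; apply: is_pdZ.
        by rewrite eq_sym; exact: is_pd_coord.
      apply/funext => v; rewrite XE 2!mxE mulr_sumr; apply: eq_bigr => b _.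
      by ring.
    rewrite [RHS]mxE; apply: eq_bigr => b _; apply: eq_bigr => e _.
    congr (_ * _ * _); rewrite mxE eqxx /=.
    exact/(is_pd_eq oU Uy)/is_pd_coord.
  rewrite XE scalemxAl.
  by rewrite connection_along_eproj // addr0.
have t0 : z.2 != 0.
  apply: contraTN r0 => /eqP z0; rewrite -zr /enorm z0 big1 ?sqrtr0 ?ltxx //.
  by move=> b _; rewrite mxE expr0n.
set C := cylinder_tangent n z.2; set E := row_base C.
have EC : E *m (Pi *m y^T) = 0.
  apply/sub_kermxP; rewrite mulmx_tr_eproj ry.
  by rewrite eq_row_base.
(* The outward unit normal [(0, t / r)], opposite to [X y]; the sign does not affect [nu^T nu]. *)
pose nu := r^-1 *: (y *m Pi).
have nuT : nu^T = r^-1 *: (Pi *m y^T) by rewrite linearZ /= trmx_mul eproj_sym.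
have GnuT : G y *m nu^T = nu^T.
  by rewrite nuT -scalemxAr mulmxA prod_metric_eproj.
have nn : nu *m nu^T = 1%:M.
  rewrite nuT /nu -scalemxAl -scalemxAr scalerA mulmxA -[y *m Pi *m Pi]mulmxA.
  rewrite eproj_idem [LHS]mx11_scalar mxE enorm_eproj ry zr; congr (_ %:M).
  by field; rewrite gt_eqF.
have Efree : row_free E by exact: row_base_free.
have Eu : E *m G y *m E^T \in unitmx.
  by apply: gram_unitmx Efree => v; exact: prod_metric_pos.
have Enu : E *m G y *m nu^T = 0.
  by rewrite -mulmxA GnuT nuT -scalemxAr EC scaler0.
have frame := frame_inverse (cylinder_tangent_rank t0) Gs Eu Enu.
have {frame} frame : E^T *m invmx (E *m G y *m E^T) *m E =
    invmx (G y) - nu^T *m nu.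
  by rewrite -frame ?addrK // -mulmxA GnuT.
rewrite /weighted_mean_curvature.
(* The ambient trace of [Pi] is [k], and the normal direction, being Euclidean of length 1, accounts
   for 1 of it. *)
have -> : tangential_div G y E (E *m D) = - r^-1 * (k%:R - 1).
  rewrite /tangential_div DE -scalemxAr -!scalemxAl -scalemxAr linearZ /=.
  congr (_ * _); rewrite -[E *m Pi *m _]mulmxA eproj_prod_metric.
  rewrite mxtrace_rotate.
  rewrite frame mulmxBr raddfB /= trace_eproj_invmx //; congr (_ - _).
  have PnuT : Pi *m nu^T = nu^T by rewrite nuT -scalemxAr mulmxA eproj_idem.
  by rewrite mulmxA mxtrace_mulC PnuT nn mxtrace1.
have -> : inner G y (grad U G (prod_in_chart i psi) y) (X y) = - r^-1 *
    ((\row_b pd U b (prod_in_chart i psi) y) *m Pi *m y^T) ord0 ord0.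
  rewrite /inner /grad mulmxKV // XE linearZ /= trmx_mul eproj_sym.
  by rewrite -scalemxAr mxE mulmxA.
by ring.
Qed.

End Cylinder.

(** * Hypersurfaces of the product *)

Section Hypersurface.
Variables (R : realType) (n k : nat) (M : riemannian R n).
Variables (S : riemannian R (n + k).-1) (F : S -> M * 'rV[R]_k).
Implicit Types (a : chart_index S) (i : chart_index M) (p : S).
Hypothesis nk_gt0 : (0 < n + k)%N.
Hypothesis F_immersion : isometric_immersion F.

Lemma hyp_dom_open a i : open (hyp_dom F a i).
Proof.
apply: openI; first exact: chart_dom_open.
have cF1 : continuous (fun p => (F p).1).
  move=> p; apply: continuous_comp; first exact: F_immersion.1.
  exact: cvg_fst.
exact: (open_comp (fun p _ => cF1 p) (chart_dom_open i)).
Qed.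

Lemma hyp_im_sub a i : hyp_im F a i `<=` chart_im a.
Proof. by move=> _ [p [ap _] <-]; exists p. Qed.

Lemma hyp_im_relatively_open a i :
  relatively_open (@first_coord (n + k).-1) (hyp_im F a i).
Proof.
have [UP oU] := chart_im_relatively_open a; split.
  by move=> x /hyp_im_sub; exact: UP.
move=> _ [p pai <-]; have ap := pai.1.
have Up : chart_im a (chart a p) by exists p.
have [e e0 eU] := oU _ Up.
have /(@subspace_continuousP _ (chart_im a) _ (chart_inv a)) ci :=
  @chart_inv_continuous _ _ S a.
have nbhs_p : nbhs (chart_inv a (chart a p)) (hyp_dom F a i).
  rewrite chart_invK //; apply: open_nbhs_nbhs; split => //.
  exact: hyp_dom_open.
have : \forall x \near within (chart_im a) (nbhs (chart a p)),
    hyp_dom F a i (chart_inv a x) := ci _ Up _ nbhs_p.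
rewrite near_withinE => /nbhs_ballP[r /= r0 rU].
exists (Num.min e r); first by rewrite lt_min e0.
move=> x px Px; have Ux : chart_im a x.
  by apply: eU => //; apply: near_pointW px; rewrite ge_min lexx.
have := Ux => -[q aq qx]; exists q => //.
rewrite -(chart_invK aq) qx; apply: rU => //; split => // b c.
rewrite (ord1 b) /ball /= distrC; apply: lt_le_trans (px c) _.
by rewrite ge_min lexx orbT.
Qed.

Lemma hyp_local_im a i x : hyp_im F a i x -> prod_im i (hyp_local F a i x).
Proof.
move=> [p [ap ip] <-]; rewrite /prod_im /= row_mxKl chart_invK //.
by exists (F p).1.
Qed.

Lemma hyp_localE a i p : chart_dom a p ->
  hyp_local F a i (chart a p) = prod_chart i (F p).
Proof. by move=> ap; rewrite /hyp_local chart_invK. Qed.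

Definition energy p : R := 2^-1 * \sum_b (F p).2 ord0 b ^+ 2.

Lemma energyE p : energy p = 2^-1 * enorm (F p).2 ^+ 2.
Proof. by rewrite enormE. Qed.

Lemma in_chart_energy a i x : in_chart a energy x =
  2^-1 * (hyp_local F a i x *m eproj R n k *m (hyp_local F a i x)^T) ord0 ord0.
Proof.
rewrite /in_chart /energy eproj_form; congr (_ * _).
by apply: eq_bigr => b _; rewrite row_mxEr expr2.
Qed.

Lemma energy_C2 : Ck_on_manifold 2 energy.
Proof.
move=> a; apply: (Ck_local (chart_im_relatively_open a)) => _ [p ap <-].
have [i ip] := chart_cover (F p).1.
have oW := hyp_im_relatively_open a i.
exists (hyp_im F a i), (in_chart a energy); split => //.
- exact: hyp_im_sub.
- by exists p.
- apply: (CkM oW); first exact: (Ck_cst oW).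
  apply: (Ck_sum oW) => b.
  have Cb := F_immersion.2.1 a i (rshift n b) 2.
  apply: (Ck_ext oW _ (CkM oW Cb Cb)) => x _.
  by rewrite row_mxEr expr2.
Qed.

Section AtPoint.
Variables (psi : M * 'rV[R]_k -> R) (N : chart_index M -> S -> 'rV[R]_(n + k)).
Hypotheses (psi_weight : is_weight psi) (N_normal : unit_normal F N).
Variables (a : chart_index S) (i : chart_index M) (p : S).
Hypothesis pai : hyp_dom F a i p.
Local Notation y := (prod_chart i (F p)).
Local Notation Pi := (eproj R n k).
Local Notation dpsi := (\row_b pd (prod_im i) b (prod_in_chart i psi) y).

Lemma hyp_im_p : hyp_im F a i (chart a p). Proof. by exists p. Qed.

Lemma pd_chart_energy c : pd (chart_im a) c (in_chart a energy) (chart a p) =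
  (hyp_frame F a i p *m Pi *m y^T) c ord0.
Proof.
rewrite -(hyp_localE i pai.1).
apply: (@pd_energy _ _ _ _ _ _ (chart_im_relatively_open a)
  (hyp_im_relatively_open a i) (@hyp_im_sub a i)).
- by move=> b; exact: F_immersion.2.1.
- exact: eproj_sym.
- by move=> z _; rewrite (in_chart_energy _ i).
- exact: hyp_im_p.
Qed.

Lemma weighted_laplacian_chart :
  weighted_laplacian (chart_im a) (metric a) (in_chart a (psi \o F))
    (in_chart a energy) (chart a p) =
  k%:R - (N i p *m Pi *m (N i p)^T) ord0 ord0 + (dpsi *m Pi *m y^T) ord0 ord0
  + hyp_curvature F psi N a i p * (N i p *m Pi *m y^T) ord0 ord0.
Proof.
have ap := pai.1; have Uy : prod_im i y.
  by rewrite -(hyp_localE _ ap); exact: hyp_local_im hyp_im_p.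
have g_induced x : hyp_im F a i x -> metric a x = jac (hyp_im F a i)
    (hyp_local F a i) x *m prod_metric i (hyp_local F a i x) *m
    (jac (hyp_im F a i) (hyp_local F a i) x)^T.
  move=> [q qai <-]; rewrite (hyp_localE i qai.1).
  exact: F_immersion.2.2.
have N_orth x : hyp_im F a i x -> jac (hyp_im F a i) (hyp_local F a i) x *m
    prod_metric i (hyp_local F a i x) *m (N i (chart_inv a x))^T = 0.
  move=> [q qai <-]; rewrite (hyp_localE i qai.1) (chart_invK qai.1).
  exact: (N_normal.2.2 a i q qai).2.
have w_restr x : hyp_im F a i x ->
    in_chart a (psi \o F) x = prod_in_chart i psi (hyp_local F a i x).
  move=> [q qai <-]; rewrite (hyp_localE i qai.1) /in_chart /= (chart_invK qai.1).
  rewrite /prod_in_chart row_mxKl row_mxKr (chart_invK qai.2).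
  by case: (F q).
have gu : metric a (chart a p) \in unitmx.
  by apply: posdef_unitmx => v v0; apply: metric_pos v0; exists p.
have := @weighted_laplacian_energy R _ _ _ (prod_im i) _
  (chart_im a) (hyp_im F a i) (@prod_im_relatively_open R n k M i)
  (chart_im_relatively_open a) (hyp_im_relatively_open a i) (@hyp_im_sub a i)
  (prod_metric i) (prod_in_chart i psi) (hyp_local F a i)
  (fun x => N i (chart_inv a x)) (metric a) (in_chart a (psi \o F))
  (in_chart a energy) (@hyp_local_im a i) (fun b => F_immersion.2.1 a i b 2)
  (fun b => N_normal.1 a i b 1) (@prod_metric_C1 R n k M i) (psi_weight i)
  (@prod_metric_sym R n k M i) g_induced N_orth w_restr (chart a p) hyp_im_p.
rewrite (hyp_localE i ap) (chart_invK ap) => H.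
have := H (prod_metric_unit Uy) (prednK nk_gt0) gu _ Pi (eproj_sym R n k)
  (prod_metric_eproj i y) (fun X Y => connection_eproj X Y Uy)
  (fun z _ => in_chart_energy a i z).
rewrite trace_eproj_invmx // => -> //.
rewrite [LHS]mx11_scalar; congr (_%:M).
exact: (N_normal.2.2 a i p pai).1.
Qed.

Lemma normal_eproj_le1 : (N i p *m Pi *m (N i p)^T) ord0 ord0 <= 1.
Proof.
have <- := (N_normal.2.2 a i p pai).1.
rewrite /inner prod_metric_form lerDr; apply: metric_form_ge0.
by rewrite row_mxKl; exists (F p).1 => //; exact: pai.2.
Qed.

(* Expanding [0 <= sum_b (r N_b -+ t_b)^2] with [r = |t|] and [|N_2| <= 1]. *)
Lemma normal_radial_le :
  `|(N i p *m Pi *m y^T) ord0 ord0| <= enorm (F p).2.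
Proof.
set r := enorm (F p).2.
have r0 : 0 <= r by exact: sqrtr_ge0.
have r2 : r ^+ 2 = \sum_b (F p).2 ord0 b ^+ 2 by exact: enormE.
have := normal_eproj_le1; rewrite !eproj_form.
set q := \sum_b _; set s := \sum_b _ => q1.
have sq (c : R) : c ^+ 2 = 1 -> 2 * c * (r * s) <= r ^+ 2 * (q + 1).
  move=> c1; rewrite -subr_ge0.
  have -> : r ^+ 2 * (q + 1) - 2 * c * (r * s) =
      \sum_b (r * N i p ord0 (rshift n b) - c * (F p).2 ord0 b) ^+ 2.
    rewrite mulrDr mulr1 {2}r2 /q /s !mulr_sumr -big_split -sumrB /=.
    apply: eq_bigr => b _; rewrite row_mxEr [RHS]sqrrB !exprMn c1; ring.
  by apply: sumr_ge0 => b _; exact: sqr_ge0.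
have sr : `|r * s| <= r ^+ 2.
  have q2 : r ^+ 2 * (q + 1) <= r ^+ 2 * 2 by rewrite ler_wpM2l ?sqr_ge0 //; lra.
  have := sq 1 (expr1n _ _); have := sq (- 1) (sqrr_sign _ 1).
  by rewrite ler_norml => ? ?; apply/andP; split; lra.
(* For [r = 0] the factor [r] cannot be cancelled, but then [t = 0] and [s] vanishes. *)
have [rn0|rp] := eqVneq r 0; last first.
  have rgt : 0 < r by rewrite lt_def rp.
  by move: sr; rewrite normrM gtr0_norm // expr2 ler_pM2l.
rewrite /s big1 ?normr0 // => b _; rewrite row_mxEr.
have : \sum_b (F p).2 ord0 b ^+ 2 == 0 by rewrite -r2 rn0 expr0n.
rewrite psumr_eq0 => [/allP/(_ b (mem_index_enum b))|c _]; last exact: sqr_ge0.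
by rewrite /= sqrf_eq0 => /eqP ->; rewrite mulr0.
Qed.

Lemma hyp_curvature_radial_ge lambda : `|hyp_curvature F psi N a i p| <= lambda ->
  - (lambda * enorm (F p).2) <=
  hyp_curvature F psi N a i p * (N i p *m Pi *m y^T) ord0 ord0.
Proof.
move=> Hl.
have : `|hyp_curvature F psi N a i p * (N i p *m Pi *m y^T) ord0 ord0| <=
    lambda * enorm (F p).2.
  by rewrite normrM ler_pM // normal_radial_le.
by rewrite ler_norml => /andP[].
Qed.

Lemma cylinder_radial lambda : 0 < enorm (F p).2 ->
  (lambda <= cylinder_curvature psi (enorm (F p).2) i (F p) <->
   lambda * enorm (F p).2 <= k%:R - 1 + (dpsi *m Pi *m y^T) ord0 ord0).
Proof.
move=> r0; rewrite cylinder_curvatureE //; last exact: pai.2.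
by rewrite mulrC ler_pdivlMr.
Qed.

Lemma weighted_laplacian_chart_ge0 lambda : (0 < k)%N ->
  `|hyp_curvature F psi N a i p| <= lambda ->
  (0 < enorm (F p).2 ->
    lambda <= cylinder_curvature psi (enorm (F p).2) i (F p)) ->
  0 <= weighted_laplacian (chart_im a) (metric a) (in_chart a (psi \o F))
    (in_chart a energy) (chart a p).
Proof.
move=> k0 Hl Hc; rewrite weighted_laplacian_chart.
have q1 := normal_eproj_le1; have Hs := hyp_curvature_radial_ge Hl.
have k1 : 1 <= k%:R :> R by rewrite ler1n.
(* At [t = 0] the terms containing [V] vanish, and [|N_2|^2 <= 1 <= k] concludes. *)
have [r0|rp] := eqVneq (enorm (F p).2) 0.
  have t0 : (F p).2 = 0.
    apply/rowP => b; rewrite mxE.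
    have : \sum_b (F p).2 ord0 b ^+ 2 == 0 by rewrite -enormE r0 expr0n.
    rewrite psumr_eq0 => [/allP/(_ b (mem_index_enum b))|c _]; last exact: sqr_ge0.
    by rewrite /= sqrf_eq0 => /eqP.
  have A0 : (dpsi *m Pi *m y^T) ord0 ord0 = 0.
    by rewrite -mulmxA mulmx_tr_eproj row_mxKr t0 trmx0 col_mx0 mulmx0 mxE.
  by rewrite A0; move: Hs q1 k1; rewrite r0 mulr0 oppr0; lra.
have rgt : 0 < enorm (F p).2 by rewrite lt_def rp sqrtr_ge0.
have := (cylinder_radial lambda rgt).1 (Hc rgt).
by move: Hs q1 k1; lra.
Qed.

Lemma cylinder_curvature_of_harmonic lambda :
  `|hyp_curvature F psi N a i p| <= lambda -> 0 < enorm (F p).2 ->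
  lambda <= cylinder_curvature psi (enorm (F p).2) i (F p) ->
  weighted_laplacian (chart_im a) (metric a) (in_chart a (psi \o F))
    (in_chart a energy) (chart a p) = 0 ->
  cylinder_curvature psi (enorm (F p).2) i (F p) = lambda.
Proof.
move=> Hl rgt Hc; rewrite weighted_laplacian_chart => L0.
have q1 := normal_eproj_le1; have Hs := hyp_curvature_radial_ge Hl.
have Hc' := (cylinder_radial lambda rgt).1 Hc.
rewrite cylinder_curvatureE //; last exact: pai.2.
apply: (@mulfI _ (enorm (F p).2)); first by rewrite gt_eqF.
rewrite mulVKf ?gt_eqF // [RHS]mulrC.
(* One inequality is [Hc']; for the other, [L0] expresses the radial quantity as [|N_2|^2 - 1] minus
   the curvature term, which is at most [lambda] times the radius. *)
by apply/eqP; rewrite eq_le; apply/andP; split => //; move: Hs q1 L0; lra.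
Qed.

End AtPoint.
End Hypersurface.

Theorem theorem5p2 (R : realType) (n k : nat) (hk : (2 <= k)%N)
    (M : riemannian R n)
    (M_connected : connected [set: M]) (M_oriented : orientable M)
    (psi : M * 'rV[R]_k -> R) (psi_weight : is_weight psi)
    (lambda r0 : R) (lambda_ge0 : 0 <= lambda) (r0_gt0 : 0 < r0)
    (cylinder_ge : forall r : R, 0 < r -> r <= r0 ->
       forall (i : chart_index M) (z : M * 'rV[R]_k),
         chart_dom i z.1 -> enorm z.2 = r ->
         lambda <= cylinder_curvature psi r i z)
    (Sigma : riemannian R (n + k).-1) (F : Sigma -> M * 'rV[R]_k)
    (N : chart_index M -> Sigma -> 'rV[R]_(n + k))
    (F_immersion : isometric_immersion F) (N_normal : unit_normal F N)
    (Sigma_connected : connected [set: Sigma])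
    (Sigma_parabolic : weighted_parabolic (psi \o F))
    (Sigma_boundary : @boundary R (n + k).-1 Sigma !=set0)
    (Sigma_ball : forall p, enorm (F p).2 <= r0)
    (Sigma_curvature : forall (a : chart_index Sigma) (i : chart_index M) p,
       hyp_dom F a i p -> `|hyp_curvature F psi N a i p| <= lambda)
    (Sigma_tangent : tangent_to_cylinder F r0) :
  (forall p, enorm (F p).2 = r0) /\
  (forall (i : chart_index M) p, chart_dom i (F p).1 ->
     cylinder_curvature psi r0 i (F p) = lambda).
Proof.
have k0 : (0 < k)%N by exact: leq_trans hk.
have nk0 : (0 < n + k)%N by rewrite addn_gt0 k0 orbT.
have [c energy_c] : exists c, forall p, energy F p = c.
  apply: Sigma_parabolic.
  - exact: energy_C2.
  - exists (2^-1 * r0 ^+ 2) => p; rewrite energyE ler_wpM2l //.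
    by rewrite ler_pXn2r ?nnegrE ?sqrtr_ge0 ?(ltW r0_gt0).
  - move=> a p ap _; have [i ip] := chart_cover (F p).1.
    have pai : hyp_dom F a i p by split.
    apply: (weighted_laplacian_chart_ge0 nk0 F_immersion psi_weight N_normal pai k0
      (Sigma_curvature a i p pai)).
    by move=> rp; exact: cylinder_ge.
  (* Tangency puts the rows of the frame in the kernel of the column [(0, t)], and the partial
     derivatives of the energy are the products of these rows with it. *)
  - move=> a p v ap bp _; rewrite big1 // => b _.
    have [i ip] := chart_cover (F p).1.
    have pai : hyp_dom F a i p by split.
    rewrite (pd_chart_energy F_immersion pai) -mulmxA mulmx_tr_eproj row_mxKr.
    have := (Sigma_tangent p bp).2 a i pai.
    by move=> /andP[/sub_kermxP -> _]; rewrite mxE mulr0.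
have radius p : enorm (F p).2 = r0.
  have [q bq] := Sigma_boundary; have [qr _] := Sigma_tangent q bq.
  have := energy_c p; rewrite -(energy_c q) !energyE qr.
  move=> /(mulfI (lt0r_neq0 _)) E; apply/eqP.
  by rewrite -(@eqrXn2 _ 2) ?sqrtr_ge0 ?(ltW r0_gt0) //; apply/eqP/E.
split=> // i p ip; have [a ap] := chart_cover p.
have pai : hyp_dom F a i p by split.
have rp : 0 < enorm (F p).2 by rewrite radius.
rewrite -[in LHS](radius p).
apply: (cylinder_curvature_of_harmonic nk0 F_immersion psi_weight N_normal pai
  (Sigma_curvature a i p pai) rp); first exact: cylinder_ge.
(* An equality of functions on all coordinates: the energy is [c] also at the arbitrary values of
   [chart_inv] outside the chart image. *)
have -> : in_chart a (energy F) = fun=> c by apply/funext => x; exact: energy_c.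
apply: (weighted_laplacian_cst (chart_im_relatively_open a)).
by exists p.
Qed.
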